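(* Let $R$ be a fully bounded, noetherian Jacobson ring, let $n\ge 1$, and let $R[x_1,\dots,x_n]$ be the polynomial ring over $R$ in $n$ central indeterminates. Then every G-left ideal of $R[x_1,\dots,x_n]$ is a finite intersection of maximal left ideals of $R[x_1,\dots,x_n]$. In particular, $R[x_1,\dots,x_n]$ is G-left Jacobson.
   Context: All rings are associative and unital. ''Central indeterminates'' means that the $x_i$ commute with each other and with all elements of $R$. For a left ideal $I$ of a ring $S$, the Jacobson radical $\sqrt[\mathrm{j}]{I}$ of $I$ is the intersection of all maximal left ideals of $S$ containing $I$. An element $a\in S$ is integral over a left ideal $I\subseteq S$ if there exist $m\ge 1$ and $r_0,\dots,r_{m-1}\in I$ with $a^m+r_{m-1}a^{m-1}+\cdots+r_1a+r_0=0$ (where $a^0=1$). A left ideal $P$ of $S$ is a G-left ideal if there exists $a\in S$ such that $a$ is not integral over $P$ but $a$ is integral over every left ideal $J$ of $S$ with $J\supsetneq P$. The G-radical $\sqrt[\mathrm{g}]{I}$ of a left ideal $I$ is the intersection of all G-left ideals of $S$ containing $I$. The ring $S$ is G-left Jacobson if $\sqrt[\mathrm{g}]{I}=\sqrt[\mathrm{j}]{I}$ for every left ideal $I\subseteq S$. An empty intersection of left ideals of $S$ is understood to be $S$. A ring $S$ is Jacobson if $\sqrt[\mathrm{j}]{P}=P$ for every prime two-sided ideal $P$ of $S$. A ring is noetherian if it is both left and right noetherian. A left ideal is essential if it has nonzero intersection with every nonzero left ideal. A ring is left bounded if every essential left ideal contains a nonzero two-sided ideal. A ring is left fully bounded if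 each of its prime factor rings is left bounded. The right-handed notions are defined analogously. A ring is fully bounded if it is both left and right fully bounded. *)

(* Defs.v *)
From HB Require Import structures.
From mathcomp Require Import all_boot all_algebra.
From mathcomp Require Import boolp classical_sets.

Set Implicit Arguments.
Unset Strict Implicit.
Unset Printing Implicit Defensive.

Import GRing.Theory.

Local Open Scope classical_set_scope.
Local Open Scope ring_scope.

Section Ideals.
Variable R : pzRingType.
Implicit Types (I J P M A B E : set R) (a b x y : R).

Definition left_ideal I : Prop :=
  [/\ I 0, forall x y, I x -> I y -> I (x + y) & forall a x, I x -> I (a * x)].

Definition two_sided_ideal I : Prop :=
  left_ideal I /\ forall x a, I x -> I (x * a).

Definition maximal_left_ideal M : Prop :=
  [/\ left_ideal M, M <> setT &
      forall J, left_ideal J -> M `<=` J -> J = M \/ J = setT].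

Definition jradical I : set R :=
  \bigcap_(M in [set M | maximal_left_ideal M /\ I `<=` M]) M.

Definition integral_over I a : Prop :=
  exists m (r : 'I_m -> R),
    [/\ (1 <= m)%N, forall i, I (r i) & a ^+ m + \sum_(i < m) r i * a ^+ i = 0].

Definition G_left_ideal P : Prop :=
  left_ideal P /\
  exists a, ~ integral_over P a /\
    forall J, left_ideal J -> P `<` J -> integral_over J a.

Definition gradical I : set R :=
  \bigcap_(P in [set P | G_left_ideal P /\ I `<=` P]) P.

Definition finite_intersection_of_maximal_left_ideals P : Prop :=
  exists k (M : 'I_k -> set R),
    (forall i, maximal_left_ideal (M i)) /\ P = \bigcap_i M i.

Definition prime_ideal P : Prop :=
  [/\ two_sided_ideal P, P <> setT &
      forall A B, two_sided_ideal A -> two_sided_ideal B ->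
        (forall a b, A a -> B b -> P (a * b)) -> A `<=` P \/ B `<=` P].

Definition essential_left_ideal E : Prop :=
  left_ideal E /\
  forall J, left_ideal J -> J <> [set 0] -> E `&` J <> [set 0].

End Ideals.

Definition G_left_jacobson (R : pzRingType) : Prop :=
  forall I : set R, left_ideal I -> gradical I = jradical I.

Definition jacobson_ring (R : pzRingType) : Prop :=
  forall P : set R, prime_ideal P -> jradical P = P.

Definition left_noetherian (R : pzRingType) : Prop :=
  forall I : nat -> set R, (forall k, left_ideal (I k)) ->
    (forall k, I k `<=` I k.+1) ->
    exists m, forall k, (m <= k)%N -> I k = I m.

Definition right_noetherian (R : pzRingType) : Prop := left_noetherian R^c.

Definition noetherian (R : pzRingType) : Prop :=
  left_noetherian R /\ right_noetherian R.

Definition left_bounded (R : pzRingType) : Prop :=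
  forall E : set R, essential_left_ideal E ->
    exists I : set R, [/\ two_sided_ideal I, I <> [set 0] & I `<=` E].

Definition right_bounded (R : pzRingType) : Prop := left_bounded R^c.

(* MathComp's ring structure on {quot I} is limited to commutative rings, so
   the factor ring by a two-sided ideal is built here on top of the additive
   quotient of the library. *)
Section FactorRing.
Variables (R : pzRingType) (I : set R) (idI : two_sided_ideal I).

Definition ideal_pred of two_sided_ideal I : {pred R} := fun x => `[< I x >].

Local Notation memI := (ideal_pred idI).

Lemma ideal_predP x : reflect (I x) (x \in memI).
Proof. exact: asboolP. Qed.

Lemma ideal_pred_zmod_closed : zmod_closed memI.
Proof.
have [[I0 ID IM] _] := idI; split=> [|x y /ideal_predP Ix /ideal_predP Iy].
  exact/ideal_predP.
by apply/ideal_predP; rewrite -mulN1r; apply: ID (IM _ _ _).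
Qed.

HB.instance Definition _ := GRing.isZmodClosed.Build R memI
  ideal_pred_zmod_closed.

Definition factor_ring : Type := Quotient.quot memI.

HB.instance Definition _ := GRing.Zmodule.on factor_ring.
HB.instance Definition _ : EqQuotient R (Quotient.equiv memI) factor_ring :=
  EqQuotient.on factor_ring.

Local Open Scope quotient_scope.

Definition factor_one : factor_ring := \pi_factor_ring 1.
Definition factor_mul (u v : factor_ring) : factor_ring :=
  \pi_factor_ring (repr u * repr v).

Lemma factor_eqP x y : \pi_factor_ring x = \pi_factor_ring y <-> I (x - y).
Proof.
split=> [/eqP|Ixy]; last first.
  by apply/eqP; rewrite -Quotient.idealrBE; apply/ideal_predP.
by rewrite -Quotient.idealrBE => /ideal_predP.
Qed.

Lemma factor_piD : {morph \pi_factor_ring : x y / x + y}.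
Proof. by move=> x y; rewrite -[RHS]Quotient.pi_add. Qed.

Lemma factor_piM x y :
  \pi_factor_ring (x * y) = factor_mul (\pi_factor_ring x) (\pi_factor_ring y).
Proof.
have [[_ ID IM] IMr] := idI.
have Ir z : I (z - repr (\pi_factor_ring z)).
  by apply/factor_eqP; rewrite reprK.
apply/factor_eqP; set x' := repr _; set y' := repr _.
have -> : x * y - x' * y' = x * (y - y') + (x - x') * y'.
  by rewrite mulrBr mulrBl addrA subrK.
by apply: ID; [apply: IM | apply: IMr]; apply: Ir.
Qed.

Lemma factor_mulA : associative factor_mul.
Proof.
move=> u v w; rewrite -[u]reprK -[v]reprK -[w]reprK.
rewrite -(factor_piM (repr v) (repr w)) -(factor_piM (repr u) (repr v)).
by rewrite -2!factor_piM mulrA.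
Qed.

Lemma factor_mul1 : left_id factor_one factor_mul.
Proof. by move=> u; rewrite -[u]reprK -factor_piM mul1r. Qed.

Lemma factor_mulr1 : right_id factor_one factor_mul.
Proof. by move=> u; rewrite -[u]reprK -factor_piM mulr1. Qed.

Lemma factor_mulDl : left_distributive factor_mul +%R.
Proof.
move=> u v w; rewrite -[u]reprK -[v]reprK -[w]reprK.
by rewrite -factor_piD -!factor_piM -factor_piD mulrDl.
Qed.

Lemma factor_mulDr : right_distributive factor_mul +%R.
Proof.
move=> u v w; rewrite -[u]reprK -[v]reprK -[w]reprK.
by rewrite -factor_piD -!factor_piM -factor_piD mulrDr.
Qed.

HB.instance Definition _ := GRing.Zmodule_isPzRing.Build factor_ring
  factor_mulA factor_mul1 factor_mulr1 factor_mulDl factor_mulDr.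

End FactorRing.

Definition left_fully_bounded (R : pzRingType) : Prop :=
  forall (P : set R) (idP : two_sided_ideal P),
    prime_ideal P -> left_bounded (factor_ring idP).

Definition right_fully_bounded (R : pzRingType) : Prop :=
  forall (P : set R) (idP : two_sided_ideal P),
    prime_ideal P -> right_bounded (factor_ring idP).

Definition fully_bounded (R : pzRingType) : Prop :=
  left_fully_bounded R /\ right_fully_bounded R.

(* Main.v *)
From HB Require Import structures.
Require Import Defs.
From mathcomp Require Import all_boot all_algebra.
From mathcomp.multinomials Require Import mpoly.
From mathcomp Require Import boolp classical_sets.

(* A G-left ideal of a ring [A] is the contraction to [A] of a maximal left
   ideal [M] of [A[t]] (Rabinowitsch's trick, with [M] containing [1 - a * t]).
   So let [A = R[x_1, ..., x_n]], let [V = A[t] / M], a simple module over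
   [R[x_1, ..., x_n, t]], and let [P] be the annihilator of [V] in [R], a prime
   ideal.  Two applications of generic flatness give the structure of [V] over [R].
   - If [N] is a primitive ideal of [R] containing [P] but not a certain ideal
     [I] not contained in [P], then [N * V <> V], whence [N = P] as [V] is
     simple; such an [N] exists since [R] is Jacobson.  So [P] is primitive and,
     by boundedness, [R / P] has no proper essential left ideal.
   - If a variable [y] acted on [V] without satisfying a monic equation, then
     [p * V <> V] for almost all members [p] of a sequence of pairwise comaximal
     monic polynomials in [y] (as in Euclid's proof that there are infinitely
     many primes), whereas [p * V = V] by simplicity.  So [V] is noetherian and
     semisimple over [R] (Amitsur-Small).
   Hence [V] contains a minimal [A]-submodule [Y] and [V] is the sum of the simple
   modules [t ^ i * Y]; the contraction of [M], the annihilator in [A] of the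
   image of [1], is then a finite intersection of maximal left ideals. *)

Set Implicit Arguments.
Unset Strict Implicit.
Unset Printing Implicit Defensive.

Import GRing.Theory.

Local Open Scope classical_set_scope.
Local Open Scope ring_scope.

(** * Ascending chain conditions *)

Definition acc (T : Type) (Q : set (set T)) : Prop :=
  forall X : nat -> set T, (forall k, Q (X k)) ->
    (forall k, X k `<=` X k.+1) ->
    exists m, forall k, (m <= k)%N -> X k = X m.

Lemma chain_le (T : Type) (X : nat -> set T) (j k : nat) :
  (forall k, X k `<=` X k.+1) -> (j <= k)%N -> X j `<=` X k.
Proof.
move=> incX /subnK<-; elim: (k - j)%N => [|i IH] //= x Xx.
by apply: incX; apply: IH.
Qed.

(** If [F] had no maximal member, dependent choice would build a strictly increasing chain in it. *)
Lemma acc_max (T : Type) (Q F : set (set T)) (X0 : set T) :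
  acc Q -> F `<=` Q -> F X0 ->
  exists2 X, F X & forall Y, F Y -> X `<=` Y -> Y `<=` X.
Proof.
move=> accQ FQ FX0; apply: contrapT => nomax.
have next (X : {X | F X}) : {Y : {Y | F Y} | sval X `<` sval Y}.
  apply: cid; apply: contrapT => noY; apply: nomax; exists (sval X).
    exact: svalP.
  move=> Y FY XY; apply: contrapT => nYX; apply: noY.
  by exists (exist _ Y FY).
pose X := fix X k := if k is k'.+1 then sval (next (X k')) else exist _ X0 FX0.
have XS k : sval (X k) `<` sval (X k.+1) by exact: svalP (next (X k)).
have [||m Xm] := accQ (fun k => sval (X k)).
- by move=> k; apply: FQ; exact: svalP.
- by move=> k; have [] := XS k.
have [_] := XS m; apply.
by rewrite (Xm m.+1).
Qed.

Lemma ex_least (Q : nat -> Prop) : (exists n, Q n) ->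
  exists2 n, Q n & forall m, (m < n)%N -> ~ Q m.
Proof.
move=> [n Qn]; have exQ : exists n, `[< Q n >] by exists n; apply/asboolP.
case: (ex_minnP exQ) => k /asboolP Qk mink; exists k => // m mk /asboolP /mink.
by rewrite leqNgt mk.
Qed.

(** * Left ideals and essentiality modulo a prime ideal *)

Section Ideals.
Variable R : pzRingType.
Implicit Types (I J P N K E L : set R).

Lemma ideal0 I : left_ideal I -> I 0. Proof. by case. Qed.
Lemma idealD I x y : left_ideal I -> I x -> I y -> I (x + y).
Proof. by case=> _ + _; apply. Qed.
Lemma idealMl I a x : left_ideal I -> I x -> I (a * x).
Proof. by case=> _ _; apply. Qed.
Lemma idealN I x : left_ideal I -> I x -> I (- x).
Proof. by move=> idI Ix; rewrite -mulN1r; apply: idealMl. Qed.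
Lemma idealB I x y : left_ideal I -> I x -> I y -> I (x - y).
Proof. by move=> idI Ix Iy; apply: idealD => //; apply: idealN. Qed.
Lemma idealBl I x y : left_ideal I -> I (x - y) -> I y -> I x.
Proof. by move=> idI Ixy Iy; rewrite -(subrK y x); apply: idealD. Qed.
Lemma idealDl I x y : left_ideal I -> I (x + y) -> I y -> I x.
Proof. by move=> idI Ixy Iy; rewrite -(addrK y x); apply: idealB. Qed.
Lemma idealDr I x y : left_ideal I -> I (x + y) -> I x -> I y.
Proof. by rewrite addrC => idI; apply: idealDl. Qed.
Lemma ideal1 I x : left_ideal I -> I 1 -> I x.
Proof. by move=> idI I1; rewrite -(mulr1 x); apply: idealMl. Qed.
Lemma ts_left I : two_sided_ideal I -> left_ideal I. Proof. by case. Qed.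
Lemma ts_mulr I x a : two_sided_ideal I -> I x -> I (x * a).
Proof. by case=> _; apply. Qed.

Lemma left_idealI I J : left_ideal I -> left_ideal J -> left_ideal (I `&` J).
Proof.
move=> idI idJ; split=> [|x y [? ?] [? ?]|a x [? ?]].
- by split; apply: ideal0.
- by split; apply: idealD.
- by split; apply: idealMl.
Qed.

Definition ideal_sum I J : set R :=
  [set x | exists i j, [/\ I i, J j & x = i + j]].

Definition principal (c : R) : set R := [set x | exists r, x = r * c].

Lemma left_ideal_sum I J :
  left_ideal I -> left_ideal J -> left_ideal (ideal_sum I J).
Proof.
move=> idI idJ; split.
- by exists 0, 0; split; rewrite ?addr0 //; apply: ideal0.
- move=> _ _ [i [j [Ii Jj ->]]] [i' [j' [Ii' Jj' ->]]].
  by exists (i + i'), (j + j'); split; [exact: idealD..|rewrite addrACA].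
- move=> a _ [i [j [Ii Jj ->]]].
  by exists (a * i), (a * j); split; [exact: idealMl..|rewrite mulrDr].
Qed.

Lemma sum_subl I J : left_ideal J -> I `<=` ideal_sum I J.
Proof. by move=> idJ x Ix; exists x, 0; split; rewrite ?addr0 //; apply: ideal0. Qed.

Lemma sum_subr I J : left_ideal I -> J `<=` ideal_sum I J.
Proof. by move=> idI x Jx; exists 0, x; split; rewrite ?add0r //; apply: ideal0. Qed.

Lemma left_ideal_principal c : left_ideal (principal c).
Proof.
split=> [|_ _ [r ->] [s ->]|a _ [r ->]].
- by exists 0; rewrite mul0r.
- by exists (r + s); rewrite mulrDl.
- by exists (a * r); rewrite mulrA.
Qed.

Lemma maximal_sum1 L x : maximal_left_ideal L -> ~ L x ->
  exists r, L (r * x - 1).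
Proof.
move=> [idL _ maxL] nLx.
have idS := left_ideal_sum idL (left_ideal_principal x).
have [SL|ST] := maxL _ idS (sum_subl (left_ideal_principal x)).
  case: nLx; rewrite -SL; apply: (sum_subr idL).
  by exists 1; rewrite mul1r.
have [l [_ [Ll [r ->] e]]] : ideal_sum L (principal x) 1 by rewrite ST.
by exists r; rewrite e opprD addrCA subrr addr0; apply: idealN.
Qed.

Lemma maximalN1 L : maximal_left_ideal L -> ~ L 1.
Proof.
move=> [idL nT _] L1; apply: nT; apply/seteqP; split=> // x _.
exact: ideal1.
Qed.

(* Relative form of essentiality: [E / P] is essential in [R / P]. *)
Definition ess P E : Prop :=
  forall J, left_ideal J -> P `<=` J -> J `&` E `<=` P -> J `<=` P.

(** [J] need not contain [P]: essentiality is applied to [J + P]. *)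
Lemma ess_exists P E J : two_sided_ideal P -> left_ideal E -> P `<=` E ->
  ess P E -> left_ideal J -> ~ J `<=` P -> exists x, [/\ J x, E x & ~ P x].
Proof.
move=> idP idE PE essE idJ nJP; apply: contrapT => no.
apply: nJP; apply: subset_trans (sum_subl (ts_left idP)) _.
apply: essE; first exact: left_ideal_sum (ts_left idP).
  exact: sum_subr.
move=> _ [[j [p [Jj Pp ->]]] Ejp]; apply: (idealD (ts_left idP)) => //.
apply: contrapT => nPj; apply: no; exists j; split=> //.
by apply: (idealDl idE Ejp); apply: PE.
Qed.

Lemma notess_exists P E : ~ ess P E ->
  exists J, [/\ left_ideal J, P `<=` J, J `&` E `<=` P & exists2 x, J x & ~ P x].
Proof.
move=> nE; apply: contrapT => no; apply: nE => J idJ PJ JE x Jx.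
by apply: contrapT => nPx; apply: no; exists J; split=> //; exists x.
Qed.

Lemma prime_ts P : prime_ideal P -> two_sided_ideal P. Proof. by case. Qed.

(** Primeness is applied to [A], the set of [x] with [x R b] inside [P], and to [B], the right
    annihilator of [A] modulo [P]. By hypothesis [a] lies in [A], and by construction [b] lies in
    [B]. *)
Lemma prime_elt P a b : prime_ideal P -> (forall r, P (a * r * b)) -> P a \/ P b.
Proof.
move=> [idP _ prP] Pab; have idPl := ts_left idP.
pose A := [set x | forall r, P (x * r * b)].
pose B := [set y | forall x r, A x -> P (x * r * y)].
have tsA : two_sided_ideal A.
  split; [split=> [r|x y Ax Ay r|c x Ax r]|move=> x c Ax r].
  - by rewrite !mul0r; apply: ideal0.
  - by rewrite !mulrDl; apply: idealD.
  - by rewrite -!mulrA; apply: idealMl => //; rewrite mulrA.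
  - by rewrite -(mulrA x).
have tsB : two_sided_ideal B.
  split; [split=> [x r _|y z By Bz x r Ax|c y By x r Ax]|move=> y c By x r Ax].
  - by rewrite mulr0; apply: ideal0.
  - by rewrite mulrDr; apply: idealD => //; [apply: By|apply: Bz].
  - by rewrite mulrA -(mulrA x); apply: By.
  - by rewrite mulrA; apply: ts_mulr => //; apply: By.
have [|AP|BP] := prP A B tsA tsB.
- by move=> x y Ax By; rewrite -(mulr1 x); apply: By.
- by left; apply: AP.
- by right; apply: BP => x r; apply.
Qed.

Lemma prime_ideal_elt P I b : prime_ideal P -> two_sided_ideal I ->
  ~ I `<=` P -> (forall i, I i -> P (i * b)) -> P b.
Proof.
move=> prP idI nIP Ib; apply: contrapT => nPb; apply: nIP => i Ii.
have [|//|//] := @prime_elt P i b prP.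
by move=> r; apply: Ib; apply: ts_mulr.
Qed.

Definition annl P (c : R) : set R := [set r | P (r * c)].

Lemma left_ideal_annl P c : left_ideal P -> left_ideal (annl P c).
Proof.
move=> idP; split=> [|x y|a x]; rewrite /annl /=.
- by rewrite mul0r; apply: ideal0.
- by rewrite mulrDl; apply: idealD.
- by rewrite -mulrA; apply: idealMl.
Qed.

Lemma sub_annl P c : two_sided_ideal P -> P `<=` annl P c.
Proof. by move=> idP x Px; apply: ts_mulr. Qed.

Lemma noeth_maxl (F : set (set R)) X0 : left_noetherian R ->
  F `<=` @left_ideal R -> F X0 ->
  exists2 X, F X & forall Y, F Y -> X `<=` Y -> Y `<=` X.
Proof. exact: acc_max. Qed.

(** * Goldie's theorem modulo a prime ideal *)

Section Goldie.
Hypothesis noethR : left_noetherian R.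

(** Levitzki's theorem modulo [P], by Utumi's argument: if [E] were nil, take [x] outside [P] with
    [x R] nil and with maximal left annihilator modulo [P]; then [x R x] lies in [P], against
    primeness. *)
Lemma exists_nonnil P E : prime_ideal P -> left_ideal E -> ~ E `<=` P ->
  exists2 a, E a & forall k, ~ P (a ^+ k).
Proof.
move=> prP idE nEP; apply: contrapT => nil.
have idP := prime_ts prP; have idPl := ts_left idP.
have nilE a : E a -> exists k, P (a ^+ k).
  by move=> Ea; apply: contrapT => no; apply: nil; exists a => // k Pk; apply: no; exists k.
have [x0 [Ex0 nPx0]] : exists x, E x /\ ~ P x.
  apply: contrapT => no; apply: nEP => x Ex; apply: contrapT => nPx.
  by apply: no; exists x.
pose G x := ~ P x /\ forall y, exists k, P ((x * y) ^+ k).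
have Gx0 : G x0.
  split=> // y; have [k Pk] := nilE _ (idealMl y idE Ex0).
  exists k.+1; suff -> : (x0 * y) ^+ k.+1 = x0 * ((y * x0) ^+ k * y).
    by apply: (idealMl _ idPl); apply: ts_mulr.
  elim: k {Pk} => [|k IH]; first by rewrite expr1 expr0 mul1r.
  by rewrite exprS IH (exprS (y * x0)) !mulrA.
have [||_ [x [nPx nilx] <-] maxx] :=
  @noeth_maxl [set annl P x | x in G] (annl P x0) noethR.
- by move=> _ [x _ <-]; apply: left_ideal_annl.
- by exists x0.
suff Pxyx y : P (x * y * x) by case: (prime_elt prP Pxyx).
have [k Pk mink] := ex_least (nilx y).
case: k => [|[|k]] in Pk mink.
- by case: nPx; apply: ideal1.
- by apply: ts_mulr => //; rewrite -(expr1 (x * y)).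
(* [x * z] is the last power of [x * y] outside [P]. By maximality its left annihilator is that of
   [x], and it contains [x * y]. *)
pose z := y * (x * y) ^+ k.
have xz : x * z = (x * y) ^+ k.+1 by rewrite exprS mulrA.
have Gxz : G (x * z).
  split=> [|w]; last by rewrite -mulrA.
  by rewrite xz; apply: mink.
have: annl P (x * z) (x * y) by rewrite /annl /= xz -exprS.
apply: maxx; first by exists (x * z).
by move=> r; rewrite /annl /= mulrA => Prx; apply: ts_mulr.
Qed.

(** Choose [c] in [E] and a left ideal [K] meeting the left annihilator of [c] inside [P], with [K]
    maximal. If that annihilator were not inside [P], essentiality and [exists_nonnil] would give a
    non-nilpotent element of [E] in it. For a suitable power [a] of this element, [c + a] works with
    [K + R a]; so [a] lies in [K] and kills [c], a contradiction. *)
Lemma goldie P E : prime_ideal P -> left_ideal E -> P `<=` E -> ess P E ->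
  exists2 c, E c & forall r, P (r * c) -> P r.
Proof.
move=> prP idE PE essE.
have idP := prime_ts prP; have idPl := ts_left idP.
pose F K := left_ideal K /\ exists2 c, E c &
  (forall r, P (r * c * c) -> P (r * c)) /\ (forall k, K k -> P (k * c) -> P k).
have [||K [idK [c Ec [ccP Kc]]] maxK] := @noeth_maxl F P noethR.
- by move=> K [].
- split=> //; exists 0; first exact: ideal0.
  by split=> // r _; rewrite mulr0; apply: ideal0.
have idA := left_ideal_annl c idPl.
exists c => // r Prc; apply: contrapT => nPr.
have nAE : ~ annl P c `&` E `<=` P.
  move=> AE; have /(_ r Prc) // : annl P c `<=` P.
  by apply: essE => //; apply: sub_annl.
have [a0 [Aa0 Ea0] nila0] := exists_nonnil prP (left_idealI idA idE) nAE.
have [||m stab] := @noethR (fun k => annl P (a0 ^+ k)).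
- by move=> k; apply: left_ideal_annl.
- by move=> k s; rewrite /annl /= exprSr mulrA => Ps; apply: ts_mulr.
(* The exponent is large enough for [a] and [a * a] to have the same left annihilator modulo [P],
   and positive so that [a] lies in [E] and [a * c] in [P]. *)
set a := a0 ^+ m.+1.
have Ea : E a by rewrite /a exprSr; apply: idealMl.
have Pac : P (a * c) by rewrite /a exprSr -mulrA; apply: idealMl.
have aaP s : P (s * a * a) -> P (s * a).
  rewrite -mulrA /a -exprD => Ps.
  suff: annl P (a0 ^+ m.+1) s by [].
  by rewrite (stab m.+1) // -(stab (m.+1 + m.+1)%N) // addSn ltnW // ltnS leq_addr.
have ca s : P (s * (c + a)) -> P (s * c) /\ P (s * a).
  rewrite mulrDr => Ps; have Psc : P (s * c).
    apply: ccP; have := ts_mulr c idP Ps; rewrite mulrDl => Psc.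
    by apply: (idealDl idPl Psc); rewrite -mulrA; apply: idealMl.
  by split=> //; apply: (idealDr idPl Ps).
pose K' := ideal_sum K (principal a).
have /maxK K'K : F K'.
  split; first exact: left_ideal_sum (left_ideal_principal a).
  exists (c + a); first exact: idealD.
  split=> [s /ca []|_ [k [_ [Kk [s ->] ->]]] /ca []].
    rewrite !mulrDr !mulrDl => Pscc Psca; apply: idealD => //.
      apply: ccP; apply: (idealDl idPl Pscc).
      by rewrite -(mulrA s a c); apply: idealMl.
    apply: aaP; apply: (idealDr idPl Psca); apply: ts_mulr => //.
    by apply: ccP; apply: (idealDl idPl Pscc); rewrite -(mulrA s a c); apply: idealMl.
  rewrite !mulrDl => Pkc Pka.
  have Pk : P k.
    by apply: Kc => //; apply: (idealDl idPl Pkc); rewrite -mulrA; apply: idealMl.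
  apply: idealD => //; apply: aaP; apply: (idealDr idPl Pka).
  exact: ts_mulr.
have Ka : K a.
  apply: K'K; first exact: sum_subl (left_ideal_principal a).
  by apply: sum_subr => //; exists 1; rewrite mul1r.
apply: (nila0 m.+1); exact: Kc.
Qed.

(** If [J] met [R c + P] inside [P] only, the sum [J + J c + J c^2 + ...] would be direct modulo
    [P]. The partial sums [X k] stabilize, and cancelling [c] repeatedly brings this down to [J]
    inside [P]. *)
Lemma ess_regular P c : two_sided_ideal P -> (forall r, P (r * c) -> P r) ->
  ess P (ideal_sum (principal c) P).
Proof.
move=> idP regc J idJ PJ JE; have idPl := ts_left idP.
pose next X := [set y | exists j x, [/\ J j, X x & y = j + x * c]].
pose X k := iter k next P.
have idX k : left_ideal (X k).
  elim: k => [//|k IH]; split=> /=.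
  - exists 0, 0; split; [exact: ideal0..|by rewrite mul0r addr0].
  - move=> _ _ [j [x [Jj Xx ->]]] [j' [x' [Jj' Xx' ->]]].
    by exists (j + j'), (x + x'); split; [exact: idealD..|rewrite mulrDl addrACA].
  - move=> a _ [j [x [Jj Xx ->]]].
    by exists (a * j), (a * x); split; [exact: idealMl..|rewrite mulrDr mulrA].
have incX k : X k `<=` X k.+1.
  elim: k => [|k IH] /= y.
    move=> Py; exists y, 0; split; [exact: PJ|exact: ideal0|].
    by rewrite mul0r addr0.
  by move=> [j [x [Jj Xx ->]]]; exists j, x; split=> //; apply: IH.
have [m stab] := @noethR X idX incX.
have PX k : P `<=` X k by apply: (chain_le incX (leq0n k)).
have down k : X k.+2 `<=` X k.+1 -> X k.+1 `<=` X k.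
  move=> dn x Xx; have [|j [x' [Jj Xx' e]]] := dn (x * c).
    by exists 0, x; split=> //; [exact: ideal0|rewrite add0r].
  have ej : j = (x - x') * c by rewrite mulrBl e addrK.
  apply: (idealBl (idX k)) Xx'; apply: PX; apply: regc; rewrite -ej.
  apply: JE; split=> //; apply: sum_subl => //.
  by exists (x - x').
have X10 : X 1%N `<=` X 0%N.
  have : X m.+1 `<=` X m by rewrite (stab m.+1).
  elim: m {stab} => // m IH /down; exact: IH.
move=> j Jj; apply: X10; exists j, 0; split=> //; first exact: ideal0.
by rewrite mul0r addr0.
Qed.

End Goldie.
End Ideals.

(** * Primitive ideals of bounded rings *)

Section Primitive.
Variable R : pzRingType.
Implicit Types (I J P N K E L : set R).

(** The annihilator of [R / L], which is the largest two-sided ideal inside [L]. The primitive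
    ideals are the cores of the maximal left ideals. *)
Definition core L : set R := [set r | forall a, L (r * a)].

Lemma core_ts L : left_ideal L -> two_sided_ideal (core L).
Proof.
move=> idL; split; [split=> [a|x y Nx Ny a|b x Nx a]|move=> x b Nx a].
- by rewrite mul0r; apply: ideal0.
- by rewrite mulrDl; apply: idealD.
- by rewrite -mulrA; apply: idealMl.
- by rewrite -mulrA.
Qed.

Lemma core_sub L : core L `<=` L.
Proof. by move=> x /(_ 1); rewrite mulr1. Qed.

Lemma sub_core L I : two_sided_ideal I -> I `<=` L -> I `<=` core L.
Proof. by move=> idI IL x Ix a; apply: IL; apply: ts_mulr. Qed.

Lemma core_prime L : maximal_left_ideal L -> prime_ideal (core L).
Proof.
move=> maxL; have [idL _ _] := maxL; split; first exact: core_ts.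
  move=> NT; apply: (maximalN1 maxL); apply: core_sub.
  by rewrite NT.
move=> A B idA idB AB; apply: contrapT => /not_orP[nA nB].
apply: nA => a Aa s; apply: contrapT => nLas.
apply: nB; apply: sub_core => // b Bb.
apply: contrapT => nLb; have [r Lr] := maximal_sum1 maxL nLb.
apply: nLas; rewrite -[a * s]opprK; apply: idealN => //.
have -> : - (a * s) = a * s * (r * b - 1) - a * (s * r * b).
  by rewrite mulrBr mulr1 !mulrA addrAC subrr add0r.
apply: idealB => //; first exact: idealMl.
apply: core_sub; apply: AB => //.
by apply: (idealMl _ (ts_left idB)).
Qed.

(** Left boundedness of the prime factor rings, restated with ideals of [R] so that the later
    arguments can compute modulo [P] without forming quotients. *)
Definition relatively_bounded : Prop :=
  forall P E, prime_ideal P -> left_ideal E -> P `<=` E -> ess P E ->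
    exists I, [/\ two_sided_ideal I, I `<=` E & ~ I `<=` P].

Lemma fully_bounded_relatively : left_fully_bounded R -> relatively_bounded.
Proof.
move=> fbR P E prP idE PE essE; have idP := prime_ts prP.
pose pi := \pi_(factor_ring idP)%qT.
have piM x y : pi (x * y) = pi x * pi y by exact: factor_piM.
have piD x y : pi (x + y) = pi x + pi y by exact: factor_piD.
have pi0 x : pi x = 0 <-> P x.
  have <- : pi 0 = 0 by apply: (@addrI _ (pi 0)); rewrite -piD !addr0.
  by rewrite factor_eqP subr0.
have piK u : pi (repr u) = u by exact: reprK.
have E_pi x : (exists2 y, E y & pi y = pi x) -> E x.
  move=> [y Ey /factor_eqP Pyx]; rewrite -[x]opprK; apply: idealN => //.
  by apply: (idealDr idE (PE _ Pyx)).
pose E' := [set u | exists2 x, E x & pi x = u].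
have idE' : left_ideal E'.
  split=> [|_ _ [x Ex <-] [y Ey <-]|a _ [x Ex <-]].
  - by exists 0; [exact: ideal0|apply/pi0; apply: ideal0 (ts_left idP)].
  - by exists (x + y); [exact: idealD|exact: piD].
  - by exists (repr a * x); [exact: idealMl|rewrite piM piK].
have [] := fbR P idP prP E'.
  split=> // J' idJ' nJ' EJ.
  pose J := [set x | J' (pi x)].
  have idJ : left_ideal J.
    split=> [|x y|a x]; rewrite /J /=.
    - by have -> : pi 0 = 0; [apply/pi0; apply: ideal0 (ts_left idP)|exact: ideal0].
    - by rewrite piD; apply: idealD.
    - by rewrite piM; apply: idealMl.
  have nJP : ~ J `<=` P.
    move=> JP; apply: nJ'; apply/seteqP; split=> u /= => [J'u|->].
      by rewrite -(piK u); apply/pi0; apply: JP; rewrite /J /= piK.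
    exact: ideal0.
  have [x [Jx Ex nPx]] := ess_exists idP idE PE essE idJ nJP.
  apply: nPx; apply/pi0; suff: (E' `&` J') (pi x) by rewrite EJ.
  by split=> //; exists x.
move=> I' [idI' nI' I'E']; exists [set x | I' (pi x)]; split.
- split=> [|x a]; last by rewrite /= piM; apply: ts_mulr.
  have idI'l := ts_left idI'.
  split=> [|x y|a x] /=.
  + by have -> : pi 0 = 0; [apply/pi0; apply: ideal0 (ts_left idP)|exact: ideal0].
  + by rewrite piD; apply: idealD.
  + by rewrite piM; apply: idealMl.
- by move=> x /I'E' [y Ey exy]; apply: E_pi; exists y.
- move=> IP; apply: nI'; apply/seteqP; split=> u /= => [I'u|->].
    by rewrite -(piK u); apply/pi0; apply: IP; rewrite /= piK.
  exact: ideal0 (ts_left idI').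
Qed.

Section Noetherian.
Hypotheses (noethR : left_noetherian R) (bR : relatively_bounded).

(** Take a left ideal inside [E] that has a right identity [f] modulo [N = core L], maximal as such.
    If [1 - f] were not in [N], a minimal left ideal modulo [N], necessarily inside the essential
    [E], could be added to it. *)
Lemma core_ess L E : maximal_left_ideal L -> left_ideal E ->
  core L `<=` E -> ess (core L) E -> E 1.
Proof.
move=> maxL idE NE essE; have [idL _ _] := maxL.
have prN := core_prime maxL; set N := core L in prN NE essE *.
have idN := prime_ts prN; have idNl := ts_left idN.
have NL : N `<=` L := @core_sub L.
have notN x : ~ N x -> exists s, ~ L (x * s).
  by move=> nNx; apply: contrapT => no; apply: nNx => s; apply: contrapT => nL; apply: no; exists s.
(* By boundedness an essential [L] would contain a two-sided ideal not inside [N], although [N] is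
   the largest one in [L]. *)
have /notess_exists [J [idJ NJ JL [j Jj nNj]]] : ~ ess N L.
  move=> /(bR prN idL NL) [I [idI IL]]; apply; exact: sub_core.
clearbody N.
(* The annihilator of [e] modulo [N] is exactly [L] ([Ne], [NLe]), so [R e] modulo [N] is a copy of
   the simple module [R / L]. *)
have [e Je L1e] : exists2 e, J e & L (1 - e).
  have [|r Lr] := maximal_sum1 maxL (x := j).
    by move=> Lj; apply: nNj; apply: JL.
  by exists (r * j); [exact: idealMl|rewrite -opprB; apply: idealN].
have Ne x : L (x * e) -> N (x * e).
  by move=> Lxe; apply: JL; split=> //; apply: idealMl.
have NLe x : L x -> N (x * e).
  move=> Lx; apply: Ne; rewrite (_ : x * e = x - x * (1 - e)).
    by apply: idealB => //; apply: idealMl.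
  by rewrite mulrBr mulr1 opprB addrC subrK.
pose F X := [/\ left_ideal X, X `<=` E &
  exists2 f, X f & forall x, X x -> N (x - x * f)].
have [||X [idX XE [f Xf Nf]] maxX] := @noeth_maxl _ F N noethR.
- by move=> X [].
- split=> //; exists 0; first exact: ideal0.
  by move=> x Nx; rewrite mulr0 subr0.
suff N1f : N (1 - f).
  by apply: (idealBl idE (NE _ N1f)); apply: XE.
apply: contrapT => nN1f.
have [s nLs] := notN _ nN1f.
have [q Lq] := maximal_sum1 maxL nLs.
have [y Lys Nyf] : exists2 y, L (y * s - 1) & N (y * f).
  exists (q * (1 - f)); rewrite -mulrA //; apply: (idealMl _ idNl).
  by rewrite mulrBl mul1r; apply: Nf.
(* [z] spans a minimal left ideal modulo [N], satisfies [z f = 0] there, and has [s] as a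
   generalized inverse: [z = z s z] modulo [N]. *)
pose z := e * y.
have Nzf : N (z * f).
  by rewrite /z -!mulrA; apply: (idealMl _ idNl).
have Lzs : L (z * s - 1).
  rewrite (_ : z * s - 1 = e * (y * s - 1) - (1 - e)).
    by apply: idealB => //; apply: idealMl.
  by rewrite mulrBr mulr1 mulrA opprB addrA subrK.
have Lz t : L (t * z * s) -> N (t * z).
  move=> Ltzs; rewrite /z mulrA; apply: (ts_mulr _ idN); apply: (Ne t).
  rewrite (_ : t * e = t * z * s - t * e * (y * s - 1)).
    by apply: idealB => //; apply: (idealMl _ idL).
  by rewrite /z mulrBr mulr1 !mulrA opprB addrC subrK.
have nNz : ~ N z.
  move=> Nz; apply: (maximalN1 maxL); rewrite -[1]opprK; apply: idealN => //.
  by apply: (idealDr idL Lzs); apply: NL; apply: ts_mulr.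
have Ez : E z.
  have idZ := left_ideal_principal z.
  have nZN : ~ principal z `<=` N by move=> zN; apply: nNz; apply: zN; exists 1; rewrite mul1r.
  have [_ [[t ->] Etz nNtz]] := ess_exists idN idE NE essE idZ nZN.
  have [u Lu] : exists u, L (u * (t * z * s) - 1).
    by apply: maximal_sum1 => // Ltzs; apply: nNtz; apply: Lz.
  have Nz : N ((u * t - 1) * z).
    apply: Lz; rewrite (_ : _ * s = u * (t * z * s) - 1 - (z * s - 1)).
      exact: idealB.
    by rewrite opprB addrA subrK !mulrBl mul1r !mulrA.
  rewrite -[z]opprK; apply: idealN => //.
  apply: (idealDr idE (x := u * (t * z))); last exact: idealMl.
  by rewrite mulrA -[X in _ - X]mul1r -mulrBl; apply: NE.
have Nzg : N (z - z * (s * z)).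
  rewrite (_ : z - z * (s * z) = (1 - z * s) * z); last first.
    by rewrite mulrBl mul1r mulrA.
  by rewrite /z mulrA; apply: ts_mulr => //; apply: NLe; rewrite -opprB; apply: idealN.
clearbody z; have idX' := left_ideal_sum idX (left_ideal_principal z).
have /maxX : F (ideal_sum X (principal z)).
  split=> //.
    by move=> _ [x [_ [Xx [t ->] ->]]]; apply: idealD => //; [exact: XE|exact: idealMl].
  (* The new right identity modulo [N] is [1 - (1 - f) * (1 - s * z)]. *)
  exists (1 - (1 - f) * (1 - s * z)).
    exists f, ((1 - f) * s * z); split=> //; first by exists ((1 - f) * s).
    by rewrite [in LHS]mulrBr mulr1 mulrA !opprB addrCA [1 + (f - 1)]addrCA subrr addr0 addrC.
  move=> _ [x [_ [Xx [t ->] ->]]].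
  rewrite [X in _ - X]mulrBr mulr1 subKr mulrA 2!mulrDl; apply: idealD => //.
  - by rewrite [x * _]mulrBr mulr1; apply: ts_mulr => //; apply: Nf.
  - rewrite -!mulrA; apply: (idealMl _ idNl).
    rewrite (mulrA z) [z * (1 - f)]mulrBr mulr1 mulrBl; apply: idealB => //.
      by rewrite mulrBr mulr1.
    exact: ts_mulr.
move=> /(_ (sum_subl (left_ideal_principal z))) X'X; apply: nNz.
apply: (idealBl idNl (Nf z _)) => //; apply: X'X; apply: sum_subr => //.
by exists 1; rewrite mul1r.
Qed.

(** [C] is maximal among the left ideals over [P] that meet [K] inside [P]. *)
Lemma complement_ess P K : two_sided_ideal P -> left_ideal K ->
  exists C, [/\ left_ideal C, P `<=` C, K `&` C `<=` P &
    ess P (ideal_sum K C)].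
Proof.
move=> idP idK; have idPl := ts_left idP.
pose F C := [/\ left_ideal C, P `<=` C & K `&` C `<=` P].
have [||C [idC PC KC] maxC] := @noeth_maxl _ F P noethR.
- by move=> C [].
- by split=> // x [].
exists C; split=> // J idJ PJ JKC x Jx; apply: (JKC); split=> //.
apply: (sum_subr idK); apply: (maxC (ideal_sum J C)).
- split; [exact: left_ideal_sum|by move=> p Pp; apply: sum_subr => //; apply: PC|].
  move=> y [Kk [j [c [Jj Cc e]]]]; subst y.
  have Pj : P j.
    apply: JKC; split=> //; rewrite -(addrK c j).
    by exists (j + c), (- c); split=> //; apply: idealN.
  by apply: KC; split=> //; apply: idealD => //; apply: PC.
- exact: sum_subr.
- exact: (sum_subl idC).
Qed.

(** Noetherian rings are Dedekind finite: modulo [N], [r * s ^+ m] kills [c ^+ m.+1], hence already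
    [c ^+ m] for large [m], and [s ^+ m * c ^+ m] is 1. *)
Lemma regular_cancel N c s : two_sided_ideal N -> N (s * c - 1) ->
  forall r, N (r * c) -> N r.
Proof.
move=> idN Nsc r Nrc; have idNl := ts_left idN.
have [||m stab] := @noethR (fun k => annl N (c ^+ k)).
- by move=> k; apply: left_ideal_annl.
- by move=> k x; rewrite /annl /= exprSr mulrA => Nx; apply: ts_mulr.
have Nk k : N (s ^+ k * c ^+ k - 1).
  elim: k => [|k IH]; first by rewrite !expr0 mul1r subrr; apply: ideal0.
  rewrite exprSr exprS (_ : _ - 1 = s ^+ k * (s * c - 1) * c ^+ k
    + (s ^+ k * c ^+ k - 1)).
    by apply: idealD => //; apply: ts_mulr => //; apply: idealMl.
  by rewrite mulrBr mulr1 mulrBl !mulrA addrA subrK.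
have Nrs : annl N (c ^+ m.+1) (r * s ^+ m).
  rewrite /annl /= exprSr (_ : _ * (_ * c) = r * (s ^+ m * c ^+ m - 1) * c + r * c).
    by apply: idealD => //; apply: ts_mulr => //; apply: idealMl.
  by rewrite mulrBr mulr1 mulrBl subrK !mulrA.
rewrite stab // /annl /= in Nrs.
rewrite -[r]opprK; apply: idealN => //; apply: (idealDr idNl _ Nrs).
by rewrite -[X in _ - X]mulr1 -mulrA -mulrBr; apply: idealMl.
Qed.

(* Vanishing of [Tor_1(R/N, R/K)] modulo [P] for almost all primitive [N]. *)
Lemma primitive_flat P K : prime_ideal P -> left_ideal K -> P `<=` K ->
  exists I, [/\ two_sided_ideal I, ~ I `<=` P &
    forall L x, maximal_left_ideal L -> P `<=` L -> ~ I `<=` core L ->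
      core L x -> K x ->
      exists n1 k1 n2 k2 p, [/\ core L n1 /\ K k1, core L n2 /\ K k2, P p &
        x = n1 * k1 + n2 * k2 + p]].
Proof.
move=> prP idK PK; have idP := prime_ts prP; have idPl := ts_left idP.
have [C [idC PC KC essKC]] := complement_ess idP idK.
have idE := left_ideal_sum idK idC.
(* A regular element modulo [P] of the form [c = k + c']; then [R c + P] is essential and contains
   the required two-sided ideal [I]. *)
have [c [k [c' [Kk Cc' ec]]] regc] :=
  goldie noethR prP idE (fun x Px => sum_subl idC (PK x Px)) essKC.
have essc := ess_regular noethR idP regc.
have idPc := left_ideal_principal c.
have [I [idI IcP nIP]] := bR prP (left_ideal_sum idPc idPl)
  (sum_subr idPc) essc.
exists I; split=> // L x maxL PL nIN Nx Kx.
have [idL _ _] := maxL; have idN := core_ts idL; have idNl := ts_left idN.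
have PN : P `<=` core L by apply: sub_core.
(* Since [core L] is prime, [core L + I] is essential modulo it, hence is everything. As [I] lies in
   [R c + P], this makes [c] left invertible modulo [core L]. *)
have [n [i [Nn Ii e1]]] : ideal_sum (core L) I 1.
  apply: (core_ess maxL (left_ideal_sum idNl (ts_left idI))).
    exact: sum_subl (ts_left idI).
  move=> J idJ NJ JE j Jj; apply: (prime_ideal_elt (core_prime maxL) idI nIN).
  move=> i Ii; apply: JE; split; first exact: idealMl.
  by apply: sum_subr => //; apply: ts_mulr.
have [_ [p0 [[s ->] Pp0 ei]]] := IcP i Ii.
have Nsc : core L (s * c - 1).
  rewrite e1 ei (_ : _ - _ = - (n + p0)); last first.
    by rewrite [n + (_ + _)]addrCA opprD addrA subrr add0r.
  by apply: (idealN idNl); apply: (idealD idNl) => //; apply: PN.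
have [_ [p [[r ->] Pp eix]]] := IcP _ (ts_mulr x idI Ii).
have Nr : core L r.
  apply: (regular_cancel idN Nsc); apply: (idealDl idNl (y := p)); last exact: PN.
  by rewrite -eix; apply: (idealMl _ idNl).
(* Here [x = n x + i x] and [i x = r c + p = r k + r c' + p], where [r c'] lies in both [K] and [C],
   hence in [P]. *)
exists n, x, r, k, (r * c' + p); split=> //.
- apply: idealD => //; apply: KC; split; last exact: idealMl.
  rewrite (_ : r * c' = i * x - r * k - p).
    apply: idealB => //; last exact: PK.
    by apply: idealB => //; apply: idealMl.
  by rewrite eix ec mulrDr addrAC addrK addrAC subrr add0r.
- by rewrite -{1}(mul1r x) e1 mulrDl eix ec mulrDr !addrA.
Qed.

End Noetherian.
End Primitive.

(** * Hilbert's basis theorem and generic flatness *)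

Section Submodules.
Variables (S : pzRingType) (V : lmodType S).
Implicit Types (A N : set S) (X U : set V) (y : S).

(** [A] is a mere set of scalars rather than a subring, so that adjoining a variable means adding
    one element to [A]. *)
Definition submod A X : Prop :=
  [/\ X 0, forall x z, X x -> X z -> X (x - z) & forall a x, A a -> X x -> X (a *: x)].

Lemma submod0 A X : submod A X -> X 0. Proof. by case. Qed.
Lemma submodB A X x z : submod A X -> X x -> X z -> X (x - z).
Proof. by case=> _ + _; apply. Qed.
Lemma submodZ A X a x : submod A X -> A a -> X x -> X (a *: x).
Proof. by case=> _ _; apply. Qed.
Lemma submodN A X x : submod A X -> X x -> X (- x).
Proof. by move=> sX Xx; rewrite -sub0r; apply: (submodB sX) => //; apply: submod0 sX. Qed.
Lemma submodD A X x z : submod A X -> X x -> X z -> X (x + z).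
Proof. by move=> sX Xx Xz; rewrite -[z]opprK; apply: (submodB sX) => //; apply: submodN sX _. Qed.

Lemma submodW A A' X : A `<=` A' -> submod A' X -> submod A X.
Proof. by move=> AA' [X0 XB XZ]; split=> // a x /AA'; apply: XZ. Qed.

Lemma submodI A X X' : submod A X -> submod A X' -> submod A (X `&` X').
Proof.
move=> sX sX'; split=> [|x z [? ?] [? ?]|a x ? [? ?]].
- by split; [exact: submod0 sX|exact: submod0 sX'].
- by split; [exact: submodB sX _ _|exact: submodB sX' _ _].
- by split; [exact: submodZ sX _ _|exact: submodZ sX' _ _].
Qed.

Lemma submod_zero A : submod A [set 0].
Proof.
split=> [//|x z /= -> ->|a x _ /= ->]; first by rewrite subr0.
by rewrite scaler0.
Qed.

Lemma submod_T A : submod A [set: V]. Proof. by []. Qed.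

Definition noeth A U : Prop := acc [set X | submod A X /\ X `<=` U].

Definition central y : Prop := forall a, a * y = y * a.

Lemma centralX y k : central y -> central (y ^+ k).
Proof. by move=> cy a; elim: k => [|k IH]; rewrite ?expr0 ?mulr1 ?mul1r // exprS mulrA cy -!mulrA IH. Qed.

Lemma scalerC a y k (x : V) : central y -> a *: (y ^+ k *: x) = y ^+ k *: (a *: x).
Proof. by move=> cy; rewrite !scalerA (centralX k cy). Qed.

(* [span_lt y U d] is the sum of the [y ^+ i *: U] for [i < d]. *)
Fixpoint span_lt y U (d : nat) : set V :=
  if d is d'.+1 then
    [set x | exists w u, [/\ span_lt y U d' w, U u & x = w + y ^+ d' *: u]]
  else [set 0].

Definition adj y U : set V := [set x | exists d, span_lt y U d x].

(** Leading coefficients in degree [d], as in Hilbert's basis theorem. The sum of the [y ^+ i *: U]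
    need not be direct, so one element may have several. *)
Definition lead y U X d : set V :=
  [set u | U u /\ exists2 w, span_lt y U d w & X (w + y ^+ d *: u)].

Section OneStep.
Variables (A : set S) (U : set V) (y : S).
Hypotheses (sU : submod A U) (cy : central y).

Lemma span_lt_submod d : submod A (span_lt y U d).
Proof.
elim: d => [|d IH] /=; first exact: submod_zero.
split.
- exists 0, 0; split; [exact: submod0 IH|exact: submod0 sU|].
  by rewrite scaler0 addr0.
- move=> _ _ [w [u [Dw Uu ->]]] [w' [u' [Dw' Uu' ->]]].
  exists (w - w'), (u - u'); split; [exact: submodB IH _ _|exact: submodB sU _ _|].
  by rewrite scalerBr opprD addrACA.
- move=> a _ Aa [w [u [Dw Uu ->]]].
  exists (a *: w), (a *: u); split; [exact: submodZ IH _ _|exact: submodZ sU _ _|].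
  by rewrite scalerDr scalerC.
Qed.

Lemma span_ltS d : span_lt y U d `<=` span_lt y U d.+1.
Proof.
move=> x Dx; exists x, 0; split=> //; first exact: submod0 sU.
by rewrite scaler0 addr0.
Qed.

Lemma span_lt_le d d' : (d <= d')%N -> span_lt y U d `<=` span_lt y U d'.
Proof. exact: (chain_le (fun k => @span_ltS k)). Qed.

Lemma span_lt_mul d x : span_lt y U d x -> span_lt y U d.+1 (y *: x).
Proof.
elim: d x => [|d IH] x /=.
  by move=> ->; exists 0, 0; split=> //; [exact: submod0 sU|rewrite !scaler0 addr0].
move=> [w [u [Dw Uu ->]]]; exists (y *: w), u; split=> //; first exact: IH.
by rewrite scalerDr scalerA -exprS.
Qed.

Lemma span_lt1 : U `<=` span_lt y U 1.
Proof. by move=> u Uu; exists 0, u; split=> //; rewrite expr0 scale1r add0r. Qed.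

Lemma sub_adj : U `<=` adj y U.
Proof. by move=> u Uu; exists 1%N; apply: span_lt1. Qed.

Lemma adj_submod : submod (A `|` [set y]) (adj y U).
Proof.
split=> [|x z [d Dx] [d' Dz]|a x [Aa|->] [d Dx]].
- by exists 0%N.
- exists (maxn d d'); apply: (submodB (span_lt_submod _)).
    exact: (span_lt_le (leq_maxl _ _)) Dx.
  exact: (span_lt_le (leq_maxr _ _)) Dz.
- by exists d; apply: (submodZ (span_lt_submod d)).
- by exists d.+1; apply: span_lt_mul.
Qed.

Lemma adj_sub X : submod (A `|` [set y]) X -> U `<=` X -> adj y U `<=` X.
Proof.
move=> sX UX x [d]; elim: d x => [|d IH] x /=.
  by move=> ->; apply: submod0 sX.
move=> [w [u [Dw Uu ->]]]; apply: (submodD sX); first exact: IH.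
elim: d {IH Dw} => [|d IH]; first by rewrite expr0 scale1r; apply: UX.
by rewrite exprS -scalerA; apply: (submodZ sX) => //; right.
Qed.

Lemma lead_submod X d : submod A X -> submod A (lead y U X d).
Proof.
move=> sX; have sD := span_lt_submod d; split.
- split; first exact: submod0 sU.
  by exists 0; [exact: submod0 sD|rewrite scaler0 addr0; apply: submod0 sX].
- move=> u u' [Uu [w Dw Xu]] [Uu' [w' Dw' Xu']].
  split; first exact: submodB sU _ _.
  exists (w - w'); first exact: submodB sD _ _.
  by rewrite scalerBr addrACA -opprD; apply: (submodB sX).
- move=> a u Aa [Uu [w Dw Xu]]; split; first exact: submodZ sU _ _.
  exists (a *: w); first exact: submodZ sD _ _.
  by rewrite -scalerC // -scalerDr; apply: (submodZ sX).
Qed.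

Lemma lead_sub X d : lead y U X d `<=` U. Proof. by move=> u []. Qed.

Lemma leadS X d : submod (A `|` [set y]) X ->
  lead y U X d `<=` lead y U X d.+1.
Proof.
move=> sX u [Uu [w Dw Xu]]; split=> //.
exists (y *: w); first exact: span_lt_mul.
by rewrite exprS -scalerA -scalerDr; apply: (submodZ sX) => //; right.
Qed.

Lemma lead_mono X X' d : X `<=` X' -> lead y U X d `<=` lead y U X' d.
Proof. by move=> XX' u [Uu [w Dw Xu]]; split=> //; exists w => //; apply: XX'. Qed.

(** Subtracting an element of [X] with the same leading coefficient lowers the degree. *)
Lemma lead_eq X X' n : submod A X -> submod A X' -> X `<=` X' ->
  (forall d, (d < n)%N -> lead y U X' d `<=` lead y U X d) ->
  forall x, X' x -> span_lt y U n x -> X x.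
Proof.
move=> sX sX' XX'; elim: n => [|n IH] ll x X'x /=.
  by move=> ->; apply: submod0 sX.
move=> [w [u [Dw Uu ex]]].
have [_ [w' Dw' Xu]] : lead y U X n u.
  by apply: ll => //; split=> //; exists w; rewrite -?ex.
rewrite -(subrK (w' + y ^+ n *: u) x); apply: (submodD sX) => //.
apply: IH; [by move=> d dn; apply: ll; apply: leqW|exact: submodB sX' _ (XX' _ Xu)|].
rewrite ex opprD addrACA subrr addr0.
exact: submodB (span_lt_submod n) _ _.
Qed.

Hypothesis nU : noeth A U.

Lemma lead_stable (X : nat -> set V) n : (forall k, submod A (X k)) ->
  (forall k, X k `<=` X k.+1) ->
  exists m, forall d k, (d < n)%N -> (m <= k)%N -> lead y U (X k) d = lead y U (X m) d.
Proof.
move=> sX incX; elim: n => [|n [m IH]]; first by exists 0%N.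
have [||m' stab] := nU (X := fun k => lead y U (X k) n).
- by move=> k; split; [exact: lead_submod|exact: lead_sub].
- by move=> k; apply: lead_mono.
exists (maxn m m') => d k; rewrite ltnS leq_eqVlt geq_max => /orP[/eqP->|dn] /andP[mk mk'].
  by rewrite stab // (stab (maxn m m')) // leq_maxr.
by rewrite IH // (IH d (maxn m m')) // leq_maxl.
Qed.

Lemma noeth_span_lt n : noeth A (span_lt y U n).
Proof.
move=> X sX incX; have sXA k : submod A (X k) by have [] := sX k.
have [m stab] := lead_stable n sXA incX.
exists m => k mk; apply/seteqP; split=> [x Xx|]; last exact: chain_le.
apply: (lead_eq (sXA m) (sXA k) (chain_le incX mk) (n := n)) => //.
- by move=> d dn; rewrite stab.
- by have [_] := sX k; apply.
Qed.

(** Hilbert's basis theorem. The diagonal chain [lead y U (X k) k] is constant from some [m] on,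
    which settles all degrees above [m] at once; the finitely many lower degrees are covered by
    [lead_stable]. *)
Lemma noeth_adj : noeth (A `|` [set y]) (adj y U).
Proof.
move=> X sX incX; have sXy k : submod (A `|` [set y]) (X k) by have [] := sX k.
have sXA k : submod A (X k) by apply: submodW (sXy k) => a; left.
have [||m stab] := nU (X := fun k => lead y U (X k) k).
- by move=> k; split; [exact: lead_submod|exact: lead_sub].
- move=> k; apply: subset_trans (leadS (sXy k.+1)).
  exact: lead_mono.
have [m' stab'] := lead_stable m sXA incX.
have big d k : (m <= d)%N -> (m <= k)%N -> lead y U (X k) d = lead y U (X m) m.
  move=> md mk; apply/seteqP; split.
    rewrite -(stab (maxn d k)); last by rewrite leq_max md.
    apply: subset_trans (lead_mono (chain_le incX (leq_maxr d k))) _.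
    apply: (chain_le (X := lead y U (X (maxn d k)))); last exact: leq_maxl.
    by move=> i; apply: leadS.
  apply: subset_trans (lead_mono (chain_le incX mk)) _.
  by apply: (chain_le (X := lead y U (X k))) => // i; apply: leadS.
exists (maxn m m') => k; rewrite geq_max => /andP[mk mk'].
apply/seteqP; split=> [x Xx|]; last by apply: chain_le => //; rewrite geq_max mk.
have [_ /(_ x Xx) [n Dx]] := sX k.
apply: (lead_eq (sXA _) (sXA k) _ _ Xx Dx).
  by apply: chain_le => //; rewrite geq_max mk.
move=> d _; have [dm|md] := ltnP d m.
  by rewrite stab' // (stab' _ (maxn m m')) ?leq_maxr.
by rewrite big // big ?leq_maxl.
Qed.

End OneStep.

(** * Several variables, purity and generic flatness *)

Fixpoint adjs (ys : seq S) U : set V :=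
  if ys is y :: ys' then adjs ys' (adj y U) else U.

Fixpoint gens (ys : seq S) A : set S :=
  if ys is y :: ys' then gens ys' (A `|` [set y]) else A.

Fixpoint all_central (ys : seq S) : Prop :=
  if ys is y :: ys' then central y /\ all_central ys' else True.

Lemma sub_gens ys A : A `<=` gens ys A.
Proof. by elim: ys A => [|y ys IH] A //=; apply: subset_trans (IH _) => a; left. Qed.

Lemma adjs_submod ys A U : submod A U -> all_central ys -> submod (gens ys A) (adjs ys U).
Proof.
elim: ys A U => [|y ys IH] A U //= sU [cy cys].
by apply: IH => //; apply: adj_submod.
Qed.

Lemma sub_adjs ys U : U `<=` adjs ys U.
Proof.
elim: ys U => [|y ys IH] U //=; apply: subset_trans (IH _).
exact: sub_adj.
Qed.

(** The product [N U]: finite sums of the [n *: u]. *)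
Inductive nspan N U : V -> Prop :=
| nspan0 : nspan N U 0
| nspanD n u x : N n -> U u -> nspan N U x -> nspan N U (n *: u + x).

Lemma nspan_mono N U U' x : U `<=` U' -> nspan N U x -> nspan N U' x.
Proof.
by move=> UU'; elim=> [|n u z Nn Uu _ IH]; constructor=> //; apply: UU'.
Qed.

Lemma nspan_add N U x z : nspan N U x -> nspan N U z -> nspan N U (x + z).
Proof.
move=> + Nz; elim=> [|n u w Nn Uu _ IH]; first by rewrite add0r.
by rewrite -addrA; constructor.
Qed.

Lemma nspan_opp N A U x : submod A U -> nspan N U x -> nspan N U (- x).
Proof.
move=> sU; elim=> [|n u w Nn Uu _ IH]; first by rewrite oppr0; constructor.
by rewrite opprD -scalerN; constructor=> //; apply: submodN sU _.
Qed.

Lemma nspan1 N U n u : N n -> U u -> nspan N U (n *: u).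
Proof. by move=> Nn Uu; rewrite -[_ *: _]addr0; constructor=> //; constructor. Qed.

(** Satisfied when [N] lies in the subring generated by [A], without having to name this subring. *)
Definition acts A N : Prop :=
  forall n X x, N n -> submod A X -> X x -> X (n *: x).

Lemma nspan_sub A N U x : acts A N -> submod A U -> nspan N U x -> U x.
Proof.
move=> aN sU; elim=> [|n u w Nn Uu _ Uw]; first exact: submod0 sU.
by apply: (submodD sU) => //; apply: aN sU _.
Qed.

(* When [N] is an ideal, this says that [X / N X -> U / N U] is injective. *)
Definition pure N U X : Prop := forall x, nspan N U x -> X x -> nspan N X x.

Section Flat.
Variables (A N : set S) (U X : set V) (y : S).
Hypotheses (sU : submod A U) (sX : submod A X) (cy : central y) (aN : acts A N).
Hypothesis pureN : forall d, pure N U (lead y U X d).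

Lemma nspan_split d x : nspan N (span_lt y U d.+1) x ->
  exists w u, [/\ nspan N (span_lt y U d) w, nspan N U u & x = w + y ^+ d *: u].
Proof.
elim=> [|n _ z Nn [w [u [Dw Uu ->]]] _ [w' [u' [Dw' Uu' ->]]]].
  by exists 0, 0; split; rewrite ?scaler0 ?addr0 //; constructor.
exists (n *: w + w'), (n *: u + u'); split; [by constructor..|].
by rewrite !scalerDr scalerC // addrACA.
Qed.

Lemma nspan_lead d u : nspan N (lead y U X d) u ->
  exists z w, [/\ nspan N X z, nspan N (span_lt y U d) w & z = w + y ^+ d *: u].
Proof.
elim=> [|n t z Nn [Ut [w Dw Xw]] _ [z' [w' [Xz' Dw' ez']]]].
  by exists 0, 0; split; rewrite ?scaler0 ?addr0 //; constructor.
exists (n *: (w + y ^+ d *: t) + z'), (n *: w + w'); split; [by constructor..|].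
by rewrite ez' !scalerDr scalerC // addrACA.
Qed.

(** The leading coefficient of [x] lies in [N U] and in [lead y U X]; by purity an element of [N X]
    has the same one, and subtracting it lowers the degree. The lemma is applied with zero summand
    from [U], and with [X] zero. *)
Lemma flat_descent d x : nspan N (span_lt y U d.+1) x ->
  (exists c u, [/\ X c, U u & x = c + u]) ->
  exists z z', [/\ nspan N X z, nspan N U z' & x = z + z'].
Proof.
elim: d x => [|d IH] x Nx [c [u0 [Xc Uu0 ex]]].
  have [w [u [Nw Nu ->]]] := nspan_split Nx.
  exists 0, u; split=> //; first by constructor.
  rewrite expr0 scale1r; congr (_ + _).
  by elim: Nw => // n v v' _ /= -> _ ->; rewrite scaler0 addr0.
have [w [u [Nw Nu exu]]] := nspan_split Nx.
have sD := span_lt_submod sU cy d.+1.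
have Uu : U u by apply: (nspan_sub aN sU Nu).
have Dw : span_lt y U d.+1 w by apply: (nspan_sub aN sD Nw).
have /(pureN Nu) /nspan_lead [z [w2 [Nz Nw2 ez]]] : lead y U X d.+1 u.
  split=> //; exists (w - u0).
    apply: (submodB sD) => //; apply: (span_lt_le sU (ltn0Sn d)).
    exact: span_lt1.
  by rewrite addrAC -exu ex addrK.
have Xz : X z by apply: (nspan_sub (aN) sX Nz).
have [||z1 [z2 [Nz1 Nz2 e]]] := IH (x - z).
- rewrite exu ez opprD addrACA subrr addr0; apply: nspan_add => //.
  exact: (nspan_opp sD Nw2).
- exists (c - z), u0; split=> //; first exact: submodB sX _ _.
  by rewrite ex addrAC.
exists (z + z1), z2; split=> //; first exact: nspan_add.
by rewrite -addrA -e addrC subrK.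
Qed.

End Flat.

(* [ev Q] is to be read "[Q i] for almost all [i]". *)
Section Filter.
Variables (I : Type) (ev : (I -> Prop) -> Prop) (N : I -> set S).
Hypotheses (evT : ev (fun=> True))
  (evW : forall Q Q' : I -> Prop, (forall i, Q i -> Q' i) -> ev Q -> ev Q')
  (evI : forall Q Q' : I -> Prop, ev Q -> ev Q' -> ev (fun i => Q i /\ Q' i)).

Lemma ev_finite (Q : nat -> I -> Prop) m : (forall d, ev (Q d)) ->
  ev (fun i => forall d, (d < m)%N -> Q d i).
Proof.
move=> evQ; elim: m => [|m IH]; first exact: evW evT.
apply: evW (evI IH (evQ m)) => i [Qlt Qm] d; rewrite ltnS leq_eqVlt.
by case/orP=> [/eqP->|/Qlt].
Qed.

Section Step.
Variables (A : set S) (U : set V) (y : S).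
Hypotheses (sU : submod A U) (cy : central y) (aN : forall i, acts A (N i)).
Hypotheses (nU : noeth A U)
  (pU : forall X, submod A X -> X `<=` U -> ev (fun i => pure (N i) U X)).

(** The leading submodules form a stationary chain in [U], so only finitely many purity conditions
    are involved. *)
Lemma ev_pure_lead X : submod (A `|` [set y]) X ->
  ev (fun i => forall d, pure (N i) U (lead y U X d)).
Proof.
move=> sX; have sXA : submod A X by apply: submodW sX => a; left.
have [||m stab] := nU (X := lead y U X).
- by move=> k; split; [exact: lead_submod|exact: lead_sub].
- by move=> k; apply: (leadS sU sX).
have evQ d : ev (fun i => pure (N i) U (lead y U X d)).
  by apply: pU; [exact: lead_submod|exact: lead_sub].
apply: evW (ev_finite m.+1 evQ) => i Qi d.
have [/Qi//|md] := ltnP d m.+1.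
by rewrite stab; [exact: Qi|exact: ltnW].
Qed.

Lemma nspan_adj i x : nspan (N i) (adj y U) x ->
  exists d, nspan (N i) (span_lt y U d.+1) x.
Proof.
elim=> [|n u z Nn [d Du] _ [d' IH]]; first by exists 0%N; constructor.
exists (maxn d d'); constructor=> //.
  by apply: (span_lt_le sU _ Du); apply: leqW; apply: leq_maxl.
apply: nspan_mono IH; apply: (span_lt_le sU).
by rewrite ltnS leq_maxr.
Qed.

(** [flat_descent] leaves a remainder in [N U] and in [X], which is absorbed by the purity of the
    intersection of [X] and [U] in [U]. *)
Lemma flat_adj X : submod (A `|` [set y]) X -> X `<=` adj y U ->
  ev (fun i => pure (N i) (adj y U) X).
Proof.
move=> sX XU; have sXA : submod A X by apply: submodW sX => a; left.
have := evI (ev_pure_lead sX) (pU (submodI sXA sU) (@subIsetr _ _ _)).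
apply: evW => i [pl pXU] x /nspan_adj [d Nx] Xx.
have [|z [z' [Nz Nz' e]]] := flat_descent sU sXA cy (@aN i) pl Nx.
  by exists x, 0; split; rewrite ?addr0 //; apply: submod0 sU.
rewrite e; apply: nspan_add => //.
apply: (nspan_mono (@subIsetl _ X U)); apply: pXU => //; split.
  have -> : z' = x - z by rewrite e addrAC subrr add0r.
  by apply: (submodB sX) => //; apply: (nspan_sub (@aN i) sXA Nz).
exact: (nspan_sub (@aN i) sU Nz').
Qed.

Lemma flat_adj_base : ev (fun i => pure (N i) (adj y U) U).
Proof.
apply: evW (ev_pure_lead (submod_zero _)) => i pl x /nspan_adj [d Nx] Ux.
have [|z [z' [Nz Nz' ->]]] := flat_descent sU (submod_zero A) cy (@aN i) pl Nx.
  by exists 0, x; split; rewrite ?add0r.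
suff -> : z = 0 by rewrite add0r.
by elim: Nz => // n u w _ /= -> _ ->; rewrite scaler0 addr0.
Qed.

End Step.

(** Induction on the variables: [flat_adj] carries the purity hypothesis from [U] to [U[y]], and
    purity is transitive along [U], [U[y]] and the remaining extension. *)
Lemma generic_flatness ys A U : submod A U -> all_central ys ->
  (forall i, acts A (N i)) -> noeth A U ->
  (forall X, submod A X -> X `<=` U -> ev (fun i => pure (N i) U X)) ->
  ev (fun i => pure (N i) (adjs ys U) U).
Proof.
elim: ys A U => [|y ys IH] A U /= sU.
  by move=> *; apply: evW evT => i _ x.
move=> [cy cys] aN nU pU.
have evs : ev (fun i => pure (N i) (adjs ys (adj y U)) (adj y U)).
  apply: (IH (A `|` [set y])) => //.
  - exact: adj_submod.
  - by move=> i n X x Nn sX; apply: (aN i n X) => //; apply: submodW sX => a; left.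
  - exact: noeth_adj.
  - exact: flat_adj.
apply: evW (evI evs (flat_adj_base sU cy aN nU pU)) => i [p1 p2] x Nx Ux.
by apply: p2 => //; apply: p1 => //; apply: sub_adj.
Qed.

End Filter.
End Submodules.

(** * Simple modules over polynomial rings *)

Section SimpleModule.
Variables (R S : pzRingType) (iota : {rmorphism R -> S}) (V : lmodType S).
Variable ys : seq S.
Implicit Types (X U : set V) (w x : V) (y : S) (r : R).

Notation base := (range iota).
Notation zeroset X := (forall x, X x -> x = 0).

Lemma gensP A a : gens ys A a -> A a \/ a \in ys.
Proof.
elim: ys A => [|y zs IH] A /=; first by left.
by case/IH => [[Aa|->]|zs_a]; rewrite ?inE ?eqxx ?zs_a ?orbT; [left|right|right].
Qed.

Lemma gens_mono A A' : A `<=` A' -> gens ys A `<=` gens ys A'.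
Proof.
elim: ys A A' => [|y zs IH] A A' AA' //=; apply: IH => a [/AA'|]; [by left|by right].
Qed.

Lemma all_centralP zs y : all_central zs -> y \in zs -> central y.
Proof.
by elim: zs => //= z zs IH [cz czs]; rewrite inE => /orP[/eqP->|/IH]; auto.
Qed.

Lemma submod_gens A X : submod A X -> (forall y x, y \in ys -> X x -> X (y *: x)) ->
  submod (gens ys A) X.
Proof.
move=> sX Xy; split; [exact: submod0 sX|by move=> x z; apply: submodB sX|].
by move=> a x /gensP[Aa|/Xy]; [apply: submodZ sX _|apply].
Qed.

Definition annV : set R := [set r | forall v : V, iota r *: v = 0].

Definition cyc w : set V := [set x | exists r, x = iota r *: w].

Lemma cyc_submod w : submod base (cyc w).
Proof.
split=> [|_ _ [r ->] [s ->]|_ _ [a _ <-] [r ->]].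
- by exists 0; rewrite rmorph0 scale0r.
- by exists (r - s); rewrite rmorphB scalerBl.
- by exists (a * r); rewrite rmorphM scalerA.
Qed.

Lemma cyc_id w : cyc w w. Proof. by exists 1; rewrite rmorph1 scale1r. Qed.

Lemma left_ideal_into X w : submod base X -> left_ideal [set r | X (iota r *: w)].
Proof.
move=> sX; split=> [|r s|a r] /=.
- by rewrite rmorph0 scale0r; apply: submod0 sX.
- by rewrite rmorphD scalerDl; apply: submodD sX.
- by rewrite rmorphM -scalerA; apply: submodZ sX _; exists a.
Qed.

Lemma annV_into X w : submod base X -> annV `<=` [set r | X (iota r *: w)].
Proof. by move=> sX r Pr; rewrite /= Pr; apply: submod0 sX. Qed.

Lemma noeth_cyc w : left_noetherian R -> noeth base (cyc w).
Proof.
move=> nR X sX incX.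
have [||m stab] := nR (fun k => [set r | X k (iota r *: w)]).
- by move=> k; apply: left_ideal_into; have [] := sX k.
- by move=> k r; apply: incX.
exists m => k mk; apply/seteqP; split; last exact: chain_le.
move=> x Xx; have [_ /(_ x Xx) [r e]] := sX k.
by move: Xx; rewrite e => Xr; have : [set r | X k (iota r *: w)] r by []; rewrite stab.
Qed.

Hypotheses (cys : all_central ys)
  (simpleV : forall X, submod (gens ys base) X -> zeroset X \/ forall x, X x).

Lemma adjs_full A U w : base `<=` A -> submod A U -> U w -> w <> 0 ->
  forall x, adjs ys U x.
Proof.
move=> bA sU Uw w0; have sA := adjs_submod sU cys.
have [z|//] := simpleV (submodW (gens_mono bA) sA).
by case: w0; apply: z; apply: sub_adjs.
Qed.

Lemma ann_submod I : two_sided_ideal I ->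
  submod (gens ys base) [set u : V | forall r, I r -> iota r *: u = 0].
Proof.
move=> idI; apply: submod_gens.
  split=> [r _|x z Ix Iz r Ir|_ x [s _ <-] Ix r Ir]; first by rewrite scaler0.
    by rewrite scalerBr Ix ?Iz ?subr0.
  by rewrite scalerA -rmorphM; apply: Ix; apply: ts_mulr.
move=> y x yys Ix r Ir; rewrite scalerA (all_centralP cys yys) -scalerA Ix //.
by rewrite scaler0.
Qed.

Lemma ann_simple I w : two_sided_ideal I -> w <> 0 ->
  (forall r, I r -> iota r *: w = 0) -> I `<=` annV.
Proof.
move=> idI w0 Iw; have [z|all r Ir v] := simpleV (ann_submod idI).
  by case: w0; apply: z.
exact: all.
Qed.

Lemma annV_ts : two_sided_ideal annV.
Proof.
split; [split=> [v|r s Pr Ps v|a r Pr v]|move=> r a Pr v].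
- by rewrite rmorph0 scale0r.
- by rewrite rmorphD scalerDl Pr Ps addr0.
- by rewrite rmorphM -scalerA Pr scaler0.
- by rewrite rmorphM -scalerA Pr.
Qed.

Lemma image_submod I : two_sided_ideal I ->
  submod (gens ys base) (nspan (iota @` I) [set: V]).
Proof.
move=> idI; apply: submod_gens.
  split.
  - by constructor.
  - move=> x z Nx Nz; apply: nspan_add => //.
    exact: (nspan_opp (submod_T V base)).
  - move=> _ x [s _ <-]; elim=> [|_ u z [r Ir <-] _ _ IH]; first by rewrite scaler0; constructor.
    rewrite scalerDr scalerA -rmorphM; constructor=> //.
    by exists (s * r) => //; apply: (idealMl _ (ts_left idI)).
move=> y x yys; elim=> [|n u z Nn _ _ IH]; first by rewrite scaler0; constructor.
rewrite scalerDr scalerA -(all_centralP cys yys) -scalerA.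
by constructor.
Qed.

Variable v0 : V.
Hypothesis v0_neq0 : v0 <> 0.

Lemma annV_prime : prime_ideal annV.
Proof.
split; first exact: annV_ts.
  move=> PT; apply: v0_neq0; have : annV 1 by rewrite PT.
  by move=> /(_ v0); rewrite rmorph1 scale1r.
move=> A B idA idB AB; apply: contrapT => /not_orP[nA nB].
apply: nB => b Bb v; apply: contrapT => bv0.
apply: nA; apply: ann_simple bv0 _ => // a Aa.
by rewrite scalerA -rmorphM AB.
Qed.

Hypotheses (noethR : left_noetherian R) (bR : relatively_bounded R).

Lemma nspan_cyc I w x : two_sided_ideal I -> nspan (iota @` I) (cyc w) x ->
  exists2 n, I n & x = iota n *: w.
Proof.
move=> idI; elim=> [|_ _ z [n In <-] [r ->] _ [n' In' ->]].
  by exists 0; [exact: ideal0 (ts_left idI)|rewrite rmorph0 scale0r].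
exists (n * r + n'); last by rewrite rmorphD rmorphM scalerDl scalerA.
by apply: (idealD (ts_left idI)) => //; apply: ts_mulr.
Qed.

Lemma annV_primitive : jradical annV `<=` annV ->
  exists2 L, maximal_left_ideal L & core L = annV.
Proof.
move=> jacP; have prP := annV_prime; have idP := annV_ts; have idPl := ts_left idP.
set P := annV in jacP prP idP idPl *.
(* If the annihilator of [v0] were essential modulo [P], boundedness would give a two-sided ideal
   not inside [P] killing [v0], hence killing [V]. So there is [b] outside [P] such that
   [r b v0 = 0] only when [r b] is in [P]. *)
have [J [idJ PJ JL [b Jb nPb]]] : exists J, [/\ left_ideal J, P `<=` J,
    J `&` [set r | iota r *: v0 = 0] `<=` P & exists2 x, J x & ~ P x].
  apply: notess_exists => essL.
  have s0 := submod_zero V base.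
  have [I [idI IL nIP]] := bR prP (left_ideal_into v0 s0) (annV_into v0 s0) essL.
  by apply: nIP; apply: ann_simple v0_neq0 IL.
pose w := iota b *: v0.
have Pw r : iota r *: w = 0 -> P (r * b).
  move=> rw0; apply: JL; split; first exact: idealMl.
  by rewrite /= rmorphM -scalerA.
have w_neq0 : w <> 0.
  by move=> w0; apply: nPb; rewrite -(mul1r b); apply: Pw; rewrite w0 scaler0.
(* Almost all means: all maximal left ideals over [P] whose core does not contain a fixed [I] not
   inside [P]. Primeness of [P] makes this stable under conjunction. *)
pose ev (Q : set R -> Prop) := exists I, [/\ two_sided_ideal I, ~ I `<=` P &
  forall L, maximal_left_ideal L -> P `<=` L -> ~ I `<=` core L -> Q L].
have : ev (fun L => pure (iota @` core L) (adjs ys (cyc w)) (cyc w)).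
  apply: (@generic_flatness _ _ _ ev (fun L => iota @` core L) _ _ _ ys base) => //.
  - exists setT; split=> //.
    by move=> TP; apply: v0_neq0; rewrite -(scale1r v0) -(rmorph1 iota); apply: TP.
  - by move=> Q Q' QQ' [I [idI nI IQ]]; exists I; split=> // L *; apply: QQ'; apply: IQ.
  - move=> Q Q' [I [idI nI IQ]] [I' [idI' nI' IQ']].
    exists (I `&` I'); split.
    + split; first exact: left_idealI (ts_left idI) (ts_left idI').
      by move=> x a [Ix I'x]; split; apply: ts_mulr.
    + move=> II'; apply: nI' => i' Ii'; apply: (prime_ideal_elt prP idI nI) => i Ii.
      apply: II'; split; first exact: ts_mulr.
      by apply: (idealMl _ (ts_left idI')).
    + move=> L maxL PL nL; split; [apply: IQ|apply: IQ'] => // IL; apply: nL.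
        by move=> x [/IL].
      by move=> x [_ /IL].
  - exact: cyc_submod.
  - by move=> L _ X x [n _ <-] sX; apply: submodZ sX _; exists n.
  - exact: noeth_cyc.
  - move=> X sX Xw.
    have [I [idI nI flatI]] := primitive_flat noethR bR prP (left_ideal_into w sX)
      (annV_into w sX).
    exists I; split=> // L maxL PL nIL x Nx Xx.
    have idN : two_sided_ideal (core L) by have [idL _ _] := maxL; apply: core_ts.
    have [n Nn ex] := nspan_cyc idN Nx; rewrite ex in Xx *.
    have [n1 [k1 [n2 [k2 [p [[Nn1 Kk1] [Nn2 Kk2] Pp ->]]]]]] := flatI L n maxL PL nIL Nn Xx.
    rewrite !rmorphD !rmorphM !scalerDl Pp addr0 -!scalerA.
    by apply: nspan_add; apply: nspan1.
move=> [I [idI nIP flatI]].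
have [i Ii nPib] : exists2 i, I i & ~ P (i * b).
  apply: contrapT => no; apply: nPb; apply: (prime_ideal_elt prP idI nIP) => i Ii.
  by apply: contrapT => nP; apply: no; exists i.
(* The Jacobson property supplies a maximal left ideal avoiding [i * b]; as [i] is in [I], its core
   does not contain [I]. *)
have [L [maxL PL nLib]] : exists L, [/\ maximal_left_ideal L, P `<=` L & ~ L (i * b)].
  apply: contrapT => no; apply: nPib; apply: jacP => L [maxL PL].
  by apply: contrapT => nL; apply: no; exists L.
have [idL _ _] := maxL; have idN := core_ts idL; have idNl := ts_left idN.
have PN : P `<=` core L by apply: sub_core.
exists L => //; apply/seteqP; split=> // n Nn; apply: contrapT => nPn.
have nIL : ~ I `<=` core L.
  by move=> IL; apply: nLib; apply: core_sub; apply: IL; apply: ts_mulr.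
have full := adjs_full (fun a h => h) (cyc_submod w) (cyc_id w) w_neq0.
have [z|all] := simpleV (image_submod idN).
  apply: nPn => v; apply: z; apply: nspan1 => //; by exists n.
(* Now [core L] times [V] is all of [V], and flatness puts [w] in [core L] times [w]. Then [b] falls
   into [core L], against the choice of [L]. *)
have /(nspan_cyc idN) [m Nm ew] : nspan (iota @` core L) (cyc w) w.
  apply: (flatI L maxL PL nIL); last exact: cyc_id.
  by apply: nspan_mono (all w) => u _; apply: full.
apply: nLib; apply: core_sub; apply: (idealMl _ idNl).
have /PN N1mb : P ((1 - m) * b).
  by apply: Pw; rewrite rmorphB rmorph1 scalerBl scale1r -ew subrr.
by rewrite mulrBl mul1r in N1mb; apply: (idealBl idNl N1mb); apply: (ts_mulr _ idN).
Qed.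
End SimpleModule.

(** * Integrality of the variables *)

Section SpanMore.
Variables (S : pzRingType) (V : lmodType S).
Implicit Types (A : set S) (U W X : set V) (y p q : S).

Lemma span_lt_mono y U W d : U `<=` W -> span_lt y U d `<=` span_lt y W d.
Proof.
move=> UW; elim: d => [|d IH] //= x [w [u [Dw Uu ->]]].
by exists w, u; split=> //; [apply: IH|apply: UW].
Qed.

Lemma span_lt_mulX A y U d k x : submod A U ->
  span_lt y U d x -> span_lt y U (d + k) (y ^+ k *: x).
Proof.
move=> sU Dx; elim: k => [|k IH]; first by rewrite addn0 expr0 scale1r.
by rewrite addnS exprS -scalerA; apply: (span_lt_mul sU).
Qed.

Lemma span_lt_sum U y d x : U 0 -> span_lt y U d x ->
  exists2 u : 'I_d -> V, (forall i, U (u i)) & x = \sum_(i < d) y ^+ i *: u i.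
Proof.
move=> U0; suff H : span_lt y U d x ->
    exists2 u : nat -> V, (forall i, U (u i)) & x = \sum_(i < d) y ^+ i *: u i.
  by move=> /H [u Uu ex]; exists u.
elim: d x => [|d IH] x /=.
  by move=> ->; exists (fun=> 0) => //; rewrite big_ord0.
move=> [w [v [/IH [u Uu ew] Uv ->]]].
exists (fun i => if i == d then v else u i) => [i|]; first by case: ifP.
rewrite big_ord_recr /= eqxx ew; congr (_ + _); apply: eq_bigr => i _.
by rewrite ltn_eqF.
Qed.

Lemma adj_integral A y U d : submod A U -> central y ->
  (forall u, U u -> span_lt y U d (y ^+ d *: u)) -> adj y U `<=` span_lt y U d.
Proof.
move=> sU cy intU; have sD := span_lt_submod sU cy d.
apply: (adj_sub (A := A)); last first.
  case: d intU {sD} => [|d] intU u Uu; last by apply: (span_lt_le sU (ltn0Sn d)); apply: span_lt1.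
  by have := intU u Uu; rewrite expr0 scale1r.
split; [exact: submod0 sD|by move=> *; apply: (submodB sD)|].
move=> a x [Aa|->]; first exact: submodZ sD _.
case: d intU {sD} => [|d] intU /=; first by move=> ->; rewrite scaler0.
move=> [w [u [Dw Uu ->]]]; rewrite scalerDr scalerA -exprS.
apply: (submodD (span_lt_submod sU cy d.+1)); last exact: intU.
exact: (span_lt_mul sU).
Qed.

Lemma noeth_integral A0 A U ys : A0 `<=` A -> submod A U -> all_central ys ->
  noeth A0 U ->
  (forall y, y \in ys -> exists d, forall u, U u -> span_lt y U d (y ^+ d *: u)) ->
  noeth A0 (adjs ys U).
Proof.
elim: ys A U => [|y ys IH] A U //= A0A sU [cy cys] nU intU.
have sU0 := submodW A0A sU.
have [d intd] := intU y (mem_head y ys).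
have sadj := adj_submod sU cy.
apply: (IH (A `|` [set y])) => //.
- by move=> a /A0A; left.
- have -> : adj y U = span_lt y U d; last exact: (noeth_span_lt sU0 cy nU).
  by apply/seteqP; split; [exact: (adj_integral sU0 cy intd)|exists d].
move=> z zys; have [e inte] := intU z (@mem_behead _ (y :: ys) z zys).
have cz : central z by exact: (all_centralP cys zys).
(* Integrality of [z] is passed from [U] to [U[y]]: the elements satisfying the equation of degree
   [e] form a submodule containing [U]. *)
exists e; pose X := [set x | adj y U x /\ span_lt z (adj y U) e (z ^+ e *: x)].
have sD := span_lt_submod sadj cz e.
suff sX : adj y U `<=` X by move=> u /sX [].
apply: (adj_sub (A := A)) => [|u Uu].
  split.
  - by split; [exact: submod0 sadj|rewrite scaler0; apply: submod0 sD].
  - move=> x x' [ax Dx] [ax' Dx']; split; first exact: submodB sadj _ _.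
    by rewrite scalerBr; apply: (submodB sD).
  - move=> a x Aa [ax Dx]; split; first exact: submodZ sadj _ _.
    by rewrite -scalerC //; apply: (submodZ sD).
split; first exact: sub_adj.
by apply: span_lt_mono (inte u Uu); apply: sub_adj.
Qed.

(* Pairwise comaximal monic polynomials in [y]: the analogues of Euclid's
   numbers are the [1 + euclid y k]. *)
Fixpoint euclid y (k : nat) : S :=
  if k is k'.+1 then (1 + euclid y k') * euclid y k' else y.

Lemma euclid_central y k : central y -> central (euclid y k).
Proof.
move=> cy; elim: k => //= k IH a.
by rewrite mulrDl mul1r mulrDr mulrDl IH mulrA IH -!mulrA IH.
Qed.

Lemma euclid_stable A y k X x : A y -> submod A X -> X x -> X (euclid y k *: x).
Proof.
move=> Ay sX Xx; elim: k x Xx => /= [|k IH] x Xx; first exact: submodZ sX _ _.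
rewrite -scalerA scalerDl scale1r; apply: (submodD sX); first exact: IH.
by apply: (IH); apply: IH.
Qed.

(** Write [q] for [euclid y k]. The submodules of those [u] in [U] with [q u] in [X] increase with
    [k]. If [(1 + q) u] is in [X], so is [q (1 + q) u]; once the chain is stationary, [q u] is in
    [X], and so is [u]. *)
Lemma euclid_pure A y U X : A y -> central y -> noeth A U -> submod A U -> submod A X ->
  exists m, forall k, (m <= k)%N -> pure [set 1 + euclid y k] U X.
Proof.
move=> Ay cy nU sU sX.
pose Y k := [set u | U u /\ X (euclid y k *: u)].
have [||m stab] := nU Y.
- move=> k; split; last by move=> u [].
  split; first by split; [exact: submod0 sU|rewrite scaler0; apply: submod0 sX].
    by move=> x z [Ux Xx] [Uz Xz]; split; [exact: submodB sU _ _|rewrite scalerBr; apply: (submodB sX)].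
  move=> a x Aa [Ux Xx]; split; first exact: submodZ sU _ _.
  by rewrite scalerA -(euclid_central k cy) -scalerA; apply: (submodZ sX).
- move=> k u [Uu Xu]; split=> //=; rewrite -scalerA scalerDl scale1r.
  by apply: (submodD sX) => //; apply: (euclid_stable k Ay sX).
exists m => k mk x Nx Xx.
have [u Uu ex] : exists2 u, U u & x = (1 + euclid y k) *: u.
  elim: {Xx} Nx => [|_ u z -> Uu _ [u' Uu' ->]].
    by exists 0; [exact: submod0 sU|rewrite scaler0].
  by exists (u + u'); [exact: submodD sU _ _|rewrite scalerDr].
rewrite ex in Xx *; apply: nspan1 => //.
have : Y k.+1 u.
  split=> //=; rewrite (_ : _ * _ = euclid y k * (1 + euclid y k)); last first.
    by rewrite mulrDr mulrDl mulr1 mul1r.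
  by rewrite -scalerA; apply: (euclid_stable k Ay sX).
rewrite stab ?leqW // -(stab k) // => -[_ Xu].
by rewrite -(addrK (euclid y k *: u) u) -{1}(scale1r u) -scalerDl; apply: (submodB sX).
Qed.

Section Monic.
Variables (A : set S) (W : set V) (y : S).
Hypotheses (sW : submod A W) (cy : central y).

(** [q] acts like a monic polynomial of degree [e] in [y]: it differs from [y ^+ e] by terms of
    lower degree. *)
Definition acts_monic q e : Prop := forall d z,
  span_lt y W d.+1 z -> span_lt y W (d + e) (q *: z - y ^+ e *: z).

Lemma acts_monicD1 q e : (0 < e)%N -> acts_monic q e -> acts_monic (1 + q) e.
Proof.
move=> e0 mq d z Dz; rewrite scalerDl scale1r -addrA.
apply: (submodD (span_lt_submod sW cy _)); last exact: mq.
by apply: (span_lt_le sW _ Dz); rewrite -addn1 leq_add2l.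
Qed.

Lemma acts_monicM p q e f : (0 < f)%N ->
  acts_monic p e -> acts_monic q f -> acts_monic (p * q) (e + f).
Proof.
move=> f0 mp mq d z Dz; have sD k := span_lt_submod sW cy k.
set z' := q *: z - y ^+ f *: z; have Dz' : span_lt y W (d + f) z' by apply: mq.
have -> : (p * q) *: z - y ^+ (e + f) *: z =
    (p *: (y ^+ f *: z) - y ^+ e *: (y ^+ f *: z)) + p *: z'.
  by rewrite -scalerA exprD -scalerA /z' scalerBr [RHS]addrC addrA subrK.
apply: (submodD (sD _)).
  rewrite addnCA addnC; apply: (mp (d + f)%N).
  by rewrite -addSn; apply: (span_lt_mulX f sW).
rewrite -(subrK (y ^+ e *: z') (p *: z')); apply: (submodD (sD _)); last first.
  by rewrite [(e + f)%N]addnC addnA; apply: (span_lt_mulX e sW).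
(* As [f] is positive, [d + f] is a successor, which is the form [acts_monic] needs. *)
move: Dz'; case: f f0 {mq} @z' => // f _ z'; rewrite addnS => /mp.
by apply: (span_lt_le sW); rewrite !addnS addnA addnAC leqnSn.
Qed.

Lemma euclid_monic k : exists2 e, (0 < e)%N & acts_monic (euclid y k) e.
Proof.
elim: k => [|k [e e0 me]] /=.
  by exists 1%N => // d z _; rewrite expr1 subrr; apply: submod0 (span_lt_submod sW cy _).
exists (e + e)%N; first by rewrite addn_gt0 e0.
by apply: acts_monicM => //; apply: acts_monicD1.
Qed.
End Monic.
End SpanMore.

Section Integrality.
Variables (R S : pzRingType) (iota : {rmorphism R -> S}) (V : lmodType S).
Variable ys : seq S.
Implicit Types (X U : set V) (w x : V) (y : S) (r : R).

Notation base := (range iota).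
Notation P := (annV iota V).

Hypotheses (cys : all_central ys)
  (simpleV : forall X, submod (gens ys base) X ->
     (forall x, X x -> x = 0) \/ forall x, X x)
  (noethR : left_noetherian R).
(* Equivalently, [R / P] is semisimple. *)
Hypothesis ssP : forall E, left_ideal E -> P `<=` E -> ess P E -> E 1.

Lemma semisimple_complement (E : set R) : left_ideal E -> P `<=` E -> ~ E 1 ->
  exists2 c, ~ P c & forall r, E (r * c) -> P (r * c).
Proof.
move=> idE PE nE1.
have /notess_exists [J [idJ PJ JE [c Jc nPc]]] : ~ ess P E.
  by move=> essE; apply: nE1; apply: ssP.
by exists c => // r Erc; apply: JE; split=> //; apply: idealMl.
Qed.

(** If [y] were not integral on [w], semisimplicity would give [w'] in [R w] on which [y] acts like
    a free variable. Then [w'] is not a multiple of a monic [p] inside [U = R[y] w'], whereas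
    simplicity of [V] and purity of [U] make it one. *)
Lemma integral_cyc y w : y \in ys ->
  exists d, span_lt y (cyc iota w) d (y ^+ d *: w).
Proof.
move=> yys; have cy := all_centralP cys yys; have sW := cyc_submod iota w.
(* [lam] is the left ideal of leading coefficients of relations between the [y ^+ i *: w];
   integrality amounts to 1 being in [lam]. *)
pose lam := [set r | exists d, span_lt y (cyc iota w) d (y ^+ d *: (iota r *: w))].
have lamS d k r : span_lt y (cyc iota w) d (y ^+ d *: (iota r *: w)) ->
    span_lt y (cyc iota w) (d + k) (y ^+ (d + k) *: (iota r *: w)).
  by rewrite addnC exprD -scalerA addnC; apply: (span_lt_mulX k sW).
have idlam : left_ideal lam.
  split=> [|r s [d Dr] [e Ds]|a r [d Dr]].
  - by exists 0%N; rewrite rmorph0 scale0r scaler0.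
  - exists (d + e)%N; rewrite rmorphD scalerDl scalerDr.
    apply: (submodD (span_lt_submod sW cy _)); first exact: lamS.
    by rewrite addnC; apply: lamS.
  - exists d; rewrite rmorphM -scalerA -scalerC //.
    by apply: (submodZ (span_lt_submod sW cy d)) => //; exists a.
have Plam : P `<=` lam by move=> r Pr; exists 0%N; rewrite Pr scaler0.
have [[d]|nlam1] := EM (lam 1); first by rewrite rmorph1 scale1r; exists d.
have [c nPc lamc] := semisimple_complement idlam Plam nlam1.
exfalso; pose w' := iota c *: w.
have w'_neq0 : w' <> 0.
  move=> w'0; apply: nPc; rewrite -(mul1r c); apply: lamc; rewrite mul1r.
  by exists 0%N; rewrite -/w' w'0 scaler0.
have sW' := cyc_submod iota w'; have sU := adj_submod sW' cy.
set A := base `|` [set y] in sU; set U := adj y (cyc iota w') in sU.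
have Ay : A y by right.
have nU : noeth A U by apply: noeth_adj => //; apply: noeth_cyc.
have W'W : cyc iota w' `<=` cyc iota w.
  by move=> _ [r ->]; exists (r * c); rewrite rmorphM scalerA.
have Uw' : U w' by apply: sub_adj; apply: cyc_id.
pose ev (Q : nat -> Prop) := exists m, forall k, (m <= k)%N -> Q k.
have [k pk] : ev (fun k => pure [set 1 + euclid y k] (adjs ys U) U).
  apply: (@generic_flatness _ _ _ ev (fun k => [set 1 + euclid y k]) _ _ _ ys A) => //.
  - by exists 0%N.
  - by move=> Q Q' QQ' [m Qm]; exists m => k /Qm /QQ'.
  - move=> Q Q' [m Qm] [m' Qm']; exists (maxn m m') => k.
    by rewrite geq_max => /andP[/Qm ? /Qm'].
  - move=> k n X x -> sX Xx; rewrite scalerDl scale1r; apply: (submodD sX) => //.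
    exact: (euclid_stable k Ay sX).
  - by move=> X sX XU; apply: (euclid_pure Ay).
have {}pk := pk k (leqnn k); set p := 1 + euclid y k in pk.
have [e e0 me] := euclid_monic sW' cy k.
have {}me : acts_monic (cyc iota w') y p e by apply: (acts_monicD1 sW' cy e0 me).
(* Up to lower terms [p] is [y ^+ e], so the leading coefficient [r * c] of [u] lies in [lam], hence
   in [P], and the leading term of [u] vanishes. *)
have regp u : U u -> cyc iota w (p *: u) -> u = 0.
  move=> [d Du] Wpu; elim: d u Du Wpu => [//|d IH] u Du Wpu.
  have [u1 [_ [Du1 [r ->] eu]]] := Du.
  suff /lamc Prc : lam (r * c).
    have eu1 : u = u1 by rewrite eu /w' [iota r *: _]scalerA -rmorphM Prc scaler0 addr0.
    by apply: IH => //; rewrite eu1.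
  exists (d + e)%N; have sD := span_lt_submod sW cy (d + e).
  rewrite rmorphM -scalerA -/w' addnC exprD -scalerA [(e + d)%N]addnC.
  have -> : y ^+ d *: (iota r *: w') = u - u1 by rewrite eu addrAC subrr add0r.
  rewrite scalerBr; apply: (submodB sD); last first.
    by apply: (span_lt_mono W'W); apply: (span_lt_mulX e sW').
  rewrite -(subKr (p *: u) (y ^+ e *: u)); apply: (submodB sD).
    apply: (span_lt_le sW (d := 1)); last exact: span_lt1.
    by rewrite addn_gt0 e0 orbT.
  by apply: (span_lt_mono W'W); apply: me.
(* As [p] is central, [p V] is a submodule; it is not zero by [regp], so it is [V]. *)
pose X := [set x | exists v : V, x = p *: v].
have cp : central p.
  by move=> a; rewrite /p mulrDl mulrDr mulr1 mul1r (euclid_central k cy).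
have sX : submod (gens ys base) X.
  split.
  - by exists 0; rewrite scaler0.
  - by move=> _ _ [v ->] [v' ->]; exists (v - v'); rewrite scalerBr.
  - by move=> a _ _ [v ->]; exists (a *: v); rewrite !scalerA cp.
apply: (w'_neq0); have [z|full] := simpleV sX.
  apply: regp => //; rewrite (z (p *: w')); last by exists w'.
  exact: submod0 sW.
have [v ev'] := full w'.
have bA : base `<=` A by left.
have allU := adjs_full cys simpleV bA sU Uw' w'_neq0.
(* Purity turns divisibility of [w'] by [p] in [V] into divisibility in [U]. *)
have : nspan [set p] U w' by apply: pk => //; rewrite ev'; apply: nspan1.
move=> Nw'; have [u Uu eu] : exists2 u, U u & w' = p *: u.
  elim: Nw' => [|_ u z -> Uu _ [u' Uu' ->]].
    by exists 0; [exact: submod0 sU|rewrite scaler0].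
  by exists (u + u'); [exact: submodD sU _ _|rewrite scalerDr].
rewrite eu (regp u Uu) ?scaler0 // -eu; apply: W'W; exact: cyc_id.
Qed.

Lemma noeth_simple w : w <> 0 -> noeth base [set: V].
Proof.
move=> w0; have sW := cyc_submod iota w.
have -> : [set: V] = adjs ys (cyc iota w).
  apply/seteqP; split=> // x _.
  exact: (adjs_full cys simpleV (fun a h => h) sW (cyc_id iota w) w0).
apply: (noeth_integral (A := base)) => //; first exact: noeth_cyc.
move=> y yys; have [d Dw] := integral_cyc w yys; have cy := all_centralP cys yys.
exists d => _ [r ->]; rewrite -scalerC //.
by apply: (submodZ (span_lt_submod sW cy d)) => //; exists r.
Qed.

(** The ascending chain condition is used on complements: take an [R]-submodule [C] maximal among
    those meeting some nonzero [A]-submodule [Y] trivially. A smaller nonzero [Z] would have, by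
    semisimplicity, some nonzero [R c x] inside [Y] meeting it trivially, and [C + R c x] would
    contradict maximality. *)
Lemma minimal_submod (A : set S) w : base `<=` A -> w <> 0 ->
  exists Y : set V, [/\ submod A Y, exists2 y, Y y & y <> 0 &
    forall Z, submod A Z -> Z `<=` Y -> (exists2 z, Z z & z <> 0) -> Y `<=` Z].
Proof.
move=> bA w0; have nV := noeth_simple w0.
pose F C := submod base C /\ exists Y : set V, [/\ submod A Y,
  exists2 y, Y y & y <> 0 & forall x, Y x -> C x -> x = 0].
have [||C [sC [Y [sY nzY YC]]] maxC] := acc_max (X0 := [set 0]) (F := F) nV.
- by move=> C [sC _]; split.
- split; first exact: submod_zero.
  by exists setT; split=> //; exists w.
exists Y; split=> // Z sZ ZY nzZ x Yx; apply: contrapT => nZx.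
have sZb := submodW bA sZ; have sYb := submodW bA sY.
have [|c nPc Zc] := semisimple_complement (left_ideal_into x sZb) (annV_into x sZb).
  by rewrite /= rmorph1 scale1r.
pose C' := [set u | exists a r, C a /\ u = a + iota r *: (iota c *: x)].
have /maxC C'C : F C'.
  split.
    split=> [|_ _ [a [r [Ca ->]]] [a' [r' [Ca' ->]]]|_ _ [s _ <-] [a [r [Ca ->]]]].
    - by exists 0, 0; split; [exact: submod0 sC|rewrite rmorph0 scale0r addr0].
    - exists (a - a'), (r - r'); split; first exact: submodB sC _ _.
      by rewrite rmorphB scalerBl opprD addrACA.
    - exists (iota s *: a), (s * r); split; first by apply: (submodZ sC) => //; exists s.
      by rewrite scalerDr rmorphM scalerA.
  exists Z; split=> // u Zu [a [r [Ca eu]]].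
  have rcx : iota r *: (iota c *: x) = iota (r * c) *: x by rewrite scalerA -rmorphM.
  have a0 : a = 0.
    apply: YC => //; rewrite -(addrK (iota r *: (iota c *: x)) a) -eu.
    apply: (submodB sY); first exact: ZY.
    by rewrite rcx; apply: (submodZ sYb) => //; exists (r * c).
  rewrite a0 add0r in eu; rewrite eu rcx; apply: Zc.
  by rewrite /= -rcx -eu.
have Ccx : C (iota c *: x).
  apply: C'C; first by move=> u Cu; exists u, 0; rewrite rmorph0 scale0r addr0.
  by exists 0, 1; rewrite add0r rmorph1 scale1r; split=> //; apply: submod0 sC.
apply: nPc; rewrite -(mul1r c); apply: Zc.
have cx0 : iota c *: x = 0.
  by apply: YC => //; apply: (submodZ sYb) => //; exists c.
by rewrite /= mul1r cx0; apply: submod0 sZ.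
Qed.

End Integrality.

(** * Annihilators of sums of simple vectors *)

Section SimpleVectors.
Variables (T S : pzRingType) (phi : {rmorphism T -> S}) (V : lmodType S).
Implicit Types (x v : V) (a b : T).

(** [v] is zero or spans a simple [T]-module; admitting zero keeps the notion stable under
    scaling. *)
Definition simple_vec v : Prop :=
  forall a, phi a *: v <> 0 -> exists b, phi (b * a) *: v = v.

Lemma simple_vecZ a v : simple_vec v -> simple_vec (phi a *: v).
Proof.
move=> sv c; rewrite scalerA -rmorphM => /sv [b eb].
by exists (a * b); rewrite scalerA -rmorphM -!mulrA rmorphM -scalerA eb.
Qed.

Lemma simple_vecB a v : simple_vec v -> simple_vec (v - phi a *: v).
Proof.
move=> sv; have -> : v - phi a *: v = phi (1 - a) *: v.
  by rewrite rmorphB rmorph1 scalerBl scale1r.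
exact: simple_vecZ.
Qed.

Lemma ann_simple_vec v : v <> 0 -> simple_vec v ->
  maximal_left_ideal [set a | phi a *: v = 0].
Proof.
move=> v0 sv; split.
- split=> [|a b|a b] /=; first by rewrite rmorph0 scale0r.
    by rewrite rmorphD scalerDl => -> ->; rewrite addr0.
  by rewrite rmorphM -scalerA => ->; rewrite scaler0.
- move=> NT; apply: v0; have : [set a | phi a *: v = 0] 1 by rewrite NT.
  by rewrite /= rmorph1 scale1r.
- move=> J idJ annJ; have [JA|nJA] := EM (J `<=` [set a | phi a *: v = 0]).
    by left; apply/seteqP.
  right; have [a Ja av] : exists2 a, J a & phi a *: v <> 0.
    apply: contrapT => no; apply: nJA => a Ja; apply: contrapT => av.
    by apply: no; exists a.
  have [b eb] := sv a av.
  apply/seteqP; split=> // x _; apply: ideal1 => //.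
  apply: (idealBl idJ (y := b * a)); last exact: idealMl.
  by apply: annJ; rewrite /= rmorphB rmorph1 scalerBl eb scale1r subrr.
Qed.

(* In a representation of [x] as a sum of simple vectors of minimal length,
   an element killing [x] kills all the terms: otherwise one of them could be
   eliminated. *)
Lemma ann_sum_simple n (u : 'I_n -> V) x : (forall i, simple_vec (u i)) ->
  x = \sum_i u i ->
  finite_intersection_of_maximal_left_ideals [set a | phi a *: x = 0].
Proof.
move=> su ex; pose Q m := exists u : 'I_m -> V, (forall i, simple_vec (u i)) /\ x = \sum_i u i.
have [m [v [sv exv]] minm] : exists2 m, Q m & forall k, (k < m)%N -> ~ Q k.
  by apply: ex_least; exists n, u.
have shorter (v' : 'I_m -> V) j : (forall i, simple_vec (v' i)) -> v' j = 0 ->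
    x <> \sum_i v' i.
  case: m minm v' j {v sv exv} => [|m] minm v' j sv' v'j ex'; first by case: j v'j.
  apply: (minm m) => //; exists (fun i => v' (lift j i)); split=> //.
  by rewrite ex' (bigD1_ord j) //= v'j add0r.
exists m, (fun i => [set a | phi a *: v i = 0]); split=> [i|].
  by apply: ann_simple_vec => // vi0; apply: (shorter v i).
apply/seteqP; split=> a /=.
  move=> ax i _ /=; apply: contrapT => /sv [b eb].
  apply: (shorter (fun k => v k - phi (b * a) *: v k) i).
  - by move=> k; apply: simple_vecB.
  - by rewrite eb subrr.
  by rewrite sumrB -scaler_sumr -exv rmorphM -scalerA ax scaler0 subr0.
move=> av; rewrite exv scaler_sumr big1 // => i _; exact: av.
Qed.
End SimpleVectors.

(** * Rabinowitsch's trick *)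

Section QuotientModule.
Variables (S : pzRingType) (M : set S) (idM : left_ideal M).

Definition quot_pred of left_ideal M : {pred S} := fun x => `[< M x >].
Local Notation memM := (quot_pred idM).

Lemma quot_pred_zmod_closed : zmod_closed memM.
Proof.
split=> [|x y /asboolP Mx /asboolP My]; apply/asboolP; first exact: ideal0.
exact: idealB.
Qed.

HB.instance Definition _ := GRing.isZmodClosed.Build S memM quot_pred_zmod_closed.

Definition quot_mod : Type := Quotient.quot memM.
HB.instance Definition _ := GRing.Zmodule.on quot_mod.
HB.instance Definition _ : EqQuotient S (Quotient.equiv memM) quot_mod :=
  EqQuotient.on quot_mod.

Local Open Scope quotient_scope.

Lemma quot_eqP x y : \pi_quot_mod x = \pi_quot_mod y <-> M (x - y).
Proof.
split=> [/eqP|Mxy]; last by apply/eqP; rewrite -Quotient.idealrBE; apply/asboolP.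
by rewrite -Quotient.idealrBE => /asboolP.
Qed.

Lemma quot_piD : {morph \pi_quot_mod : x y / x + y}.
Proof. by move=> x y; rewrite -[RHS]Quotient.pi_add. Qed.

Definition quot_scale (s : S) (u : quot_mod) : quot_mod := \pi_quot_mod (s * repr u).

Lemma quot_piZ s x : quot_scale s (\pi_quot_mod x) = \pi_quot_mod (s * x).
Proof.
apply/quot_eqP; rewrite -mulrBr; apply: idealMl => //.
by apply/quot_eqP; rewrite reprK.
Qed.

Lemma quot_scalerA s t u : quot_scale s (quot_scale t u) = quot_scale (s * t) u.
Proof. by rewrite -[u]reprK (quot_piZ t) !quot_piZ mulrA. Qed.

Lemma quot_scale1r : left_id 1 quot_scale.
Proof. by move=> u; rewrite -[u]reprK quot_piZ mul1r. Qed.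

Lemma quot_scalerDr : right_distributive quot_scale +%R.
Proof.
move=> s u v; rewrite -[u]reprK -[v]reprK -quot_piD !quot_piZ -quot_piD.
by rewrite mulrDr.
Qed.

Lemma quot_scalerDl u : {morph quot_scale^~ u : s t / s + t}.
Proof.
by move=> s t; rewrite -[u]reprK !quot_piZ -quot_piD mulrDl.
Qed.

HB.instance Definition _ := GRing.Zmodule_isLmodule.Build S quot_mod
  quot_scalerA quot_scale1r quot_scalerDr quot_scalerDl.

(** [V] is [S / M] and [v] is the class of 1. *)
Lemma cyclic_module : exists (V : lmodType S) (v : V),
  (forall x, exists s, x = s *: v) /\ (forall s, s *: v = 0 <-> M s).
Proof.
exists quot_mod, (\pi_quot_mod 1).
have piZ s : s *: (\pi_quot_mod 1 : quot_mod) = \pi_quot_mod s.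
  by rewrite -[LHS]/(quot_scale _ _) quot_piZ mulr1.
split=> [x|s]; first by exists (repr x); rewrite piZ reprK.
have <- : \pi_quot_mod 0 = 0 :> quot_mod.
  by apply: (@addrI _ (\pi_quot_mod 0)); rewrite -quot_piD !addr0.
by rewrite piZ quot_eqP subr0.
Qed.

End QuotientModule.

Section Zorn.
Variable S : pzRingType.

Lemma exists_maximal (L : set S) : left_ideal L -> ~ L 1 ->
  exists2 M, maximal_left_ideal M & L `<=` M.
Proof.
move=> idL nL1.
pose Q (A : set S) := A = set0 \/ [/\ left_ideal A, L `<=` A & ~ A 1].
have [F FQ totF|M [QM maxM]] := Zorn_bigcup (P := Q).
  have [[A FA nA0]|allE] := EM (exists2 A, F A & A <> set0); last first.
    left; apply/seteqP; split=> // x [A FA Ax]; apply: allE; exists A => // A0.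
    by rewrite A0 in Ax.
  have idF B x : F B -> B x -> [/\ left_ideal B, L `<=` B & ~ B 1].
    by move=> /FQ [->|//].
  have [//|[idA LA _]] := FQ _ FA; right; split.
  - split; first by exists A => //; apply: ideal0.
      move=> x y [B FB Bx] [C FC Cy].
      have [idB _ _] := idF _ _ FB Bx; have [idC _ _] := idF _ _ FC Cy.
      have [BC|CB] := totF _ _ FB FC.
        by exists C => //; apply: idealD => //; apply: BC.
      by exists B => //; apply: idealD => //; apply: CB.
    move=> a x [B FB Bx]; exists B => //; have [idB _ _] := idF _ _ FB Bx.
    exact: idealMl.
  - by move=> x Lx; exists A => //; apply: LA.
  - by move=> [B FB B1]; have [_ _] := idF _ _ FB B1.
have [idM LM nM1] : [/\ left_ideal M, L `<=` M & ~ M 1].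
  case: QM => [M0|//]; exfalso; apply: (maxM L); last by right; split.
  by rewrite M0; split=> // /(_ 0 (ideal0 idL)).
exists M => //; split=> //; first by move=> MT; apply: nM1; rewrite MT.
move=> J idJ MJ; have [J1|nJ1] := EM (J 1).
  by right; apply/seteqP; split=> // x _; apply: ideal1.
left; apply/seteqP; split=> //; apply: contrapT => nJM.
by apply: (maxM J) => //; right; split=> //; exact: subset_trans LM MJ.
Qed.
End Zorn.

Section Rabinowitsch.
Variable A : nzRingType.
Implicit Types (P : set A) (M : set {poly A}) (a : A).

Definition contraction M : set A := [set a | M a%:P].

Lemma left_ideal_contraction M : left_ideal M -> left_ideal (contraction M).
Proof.
move=> idM; split=> [|x y|a x]; rewrite /contraction /=.
- by rewrite polyC0; apply: ideal0.
- by rewrite polyCD; apply: (idealD idM).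
- by rewrite polyCM; apply: (idealMl _ idM).
Qed.

(** The left ideal [P[t] + A[t] (1 - a t)]. *)
Definition rabinowitsch P a : set {poly A} :=
  [set f | exists g q : {poly A}, (forall i, P g`_i) /\ f = g + q * (1 - a%:P * 'X)].

Lemma rabinowitsch_left_ideal P a : left_ideal P -> left_ideal (rabinowitsch P a).
Proof.
move=> idP; split.
- by exists 0, 0; split=> [i|]; rewrite ?coef0 ?mul0r ?addr0 //; apply: ideal0.
- move=> _ _ [g [q [Pg ->]]] [g' [q' [Pg' ->]]]; exists (g + g'), (q + q').
  by split=> [i|]; [rewrite coefD; apply: idealD|rewrite mulrDl addrACA].
- move=> f _ [g [q [Pg ->]]]; exists (f * g), (f * q).
  split=> [i|]; last by rewrite mulrDr mulrA.
  rewrite coefM; elim/big_ind: _ => [|x y Px Py|j _]; first exact: ideal0.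
    exact: idealD.
  exact: idealMl.
Qed.

(** Comparing coefficients in [1 = g + q (1 - a t)] expresses each coefficient of [q] as a power of
    [a] minus a combination of lower or equal powers with coefficients in [P]; beyond the degree of
    [q] it is zero. *)
Lemma rabinowitsch_proper P a : left_ideal P -> ~ integral_over P a ->
  ~ rabinowitsch P a 1.
Proof.
move=> idP nint [g [q [Pg e]]]; apply: nint.
have ek k : (k == 0)%:R = g`_k + (q`_k - (if k == 0%N then 0 else q`_k.-1 * a)).
  rewrite -coef1 e coefD mulrBr mulr1 mulrA coefB coefMX coefMC.
  by case: k.
have qS k : q`_k.+1 = q`_k * a - g`_k.+1.
  have /= /esym/eqP := ek k.+1.
  by rewrite addrA subr_eq0 => /eqP <-; rewrite [g`__ + _]addrC addrK.
have qk k : q`_k = a ^+ k - \sum_(i < k.+1) g`_(k - i) * a ^+ i.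
  elim: k => [|k IH].
    rewrite big_ord1 subn0 expr0 mulr1; have := ek 0%N; rewrite mulr1n subr0 => ->.
    by rewrite [g`_0 + _]addrC addrK.
  rewrite qS IH mulrBl -exprSr [in RHS]big_ord_recl subn0 expr0 mulr1.
  rewrite opprD addrA addrAC; congr (_ - _ - _).
  rewrite mulr_suml; apply: eq_bigr => i _.
  by rewrite lift0 subSS exprSr mulrA.
have := qk (size q); rewrite nth_default //; set d := size q => qd.
(* The relation for [a ^+ d] also has [a ^+ d] on its right-hand side; multiplying it by [a] on the
   left makes it monic of degree [d.+1], with coefficients still in the left ideal [P]. *)
exists d.+1, (fun i : 'I_d.+1 => - (a * g`_(d - i))); split=> // [i|].
  by apply: idealN => //; apply: idealMl.
rewrite -[RHS](mulr0 a) [in RHS]qd mulrBr exprS mulr_sumr -sumrN.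
by congr (_ + _); apply: eq_bigr => i _; rewrite mulNr mulrA.
Qed.

(** If the contraction were strictly larger than [P], [a] would satisfy a monic equation over it.
    Multiplied by [t ^ m] and reduced by [a t = 1] modulo [M], the equation puts 1 in [M]. *)
Lemma G_left_contraction P : G_left_ideal P ->
  exists2 M, maximal_left_ideal M & P = contraction M.
Proof.
move=> [idP [a [nint intJ]]].
have [M maxM LM] := exists_maximal (rabinowitsch_left_ideal a idP)
  (rabinowitsch_proper idP nint).
have [idM _ _] := maxM; exists M => //; have idC := left_ideal_contraction idM.
have PC : P `<=` contraction M.
  move=> x Px; apply: LM; exists x%:P, 0; split=> [i|]; last by rewrite mul0r addr0.
  by rewrite coefC; case: ifP => // _; apply: ideal0.
(* [M] is only a left ideal, so [a t] can be replaced by 1 only as a rightmost factor. *)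
have at1 f : M (f * (a%:P * 'X) - f).
  rewrite -[_ - _]opprK; apply: idealN => //; apply: LM; exists 0, f.
  split=> [i|]; first by rewrite coef0; apply: ideal0.
  by rewrite add0r opprB mulrBr mulr1.
apply/seteqP; split=> //; apply: contrapT => nCP.
have [||m [r [m0 Cr e]]] := intJ (contraction M) => //.
apply: (maximalN1 maxM).
have atk k : M (1 - (a%:P * 'X) ^+ k).
  elim: k => [|k IH]; first by rewrite expr0 subrr; apply: ideal0.
  rewrite exprSr (_ : _ - _ = 1 - (a%:P * 'X) ^+ k -
      ((a%:P * 'X) ^+ k * (a%:P * 'X) - (a%:P * 'X) ^+ k)).
    exact: idealB.
  by rewrite opprB addrA subrK.
have expX k : (a%:P * 'X) ^+ k = (a ^+ k)%:P * 'X^k.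
  by rewrite exprMn_comm ?polyC_exp //; apply: commr_polyX.
apply: (idealBl idM (atk m)); rewrite expX.
have -> : a ^+ m = - \sum_(i < m) r i * a ^+ i by apply/eqP; rewrite -addr_eq0 e.
rewrite polyCN mulNr; apply: idealN => //; rewrite rmorph_sum mulr_suml /=.
elim/big_ind: _ => [|f h Mf Mh|i _]; [exact: ideal0|exact: idealD|].
have -> : (r i * a ^+ i)%:P * 'X^m = 'X^(m - i) * (r i)%:P * (a%:P * 'X) ^+ i.
  rewrite expX polyCM -['X^(m - i) * _]commr_polyXn -!mulrA; congr (_ * _).
  by rewrite mulrA -commr_polyXn -mulrA -exprD subnK // ltnW.
have Mr : M ('X^(m - i) * (r i)%:P) by apply: idealMl => //; apply: Cr.
rewrite -[_ * _ ^+ i](subKr ('X^(m - i) * (r i)%:P)); apply: idealB => //.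
rewrite -[X in X - _]mulr1 -mulrBr; exact: idealMl.
Qed.

(** The element 1 serves as witness: an equation for it over [P] would put 1 in [P]. *)
Lemma maximal_G_left (P : set A) : maximal_left_ideal P -> G_left_ideal P.
Proof.
move=> maxP; have [idP _ mP] := maxP; split=> //; exists 1; split.
  move=> [m [r [_ Pr]]]; rewrite expr1n => e; apply: (maximalN1 maxP).
  have -> : 1 = - \sum_(i < m) r i * 1 ^+ i by apply/eqP; rewrite -addr_eq0 e.
  apply: idealN => //; elim/big_ind: _ => [|x y Px Py|i _].
  - exact: ideal0.
  - exact: idealD.
  - by rewrite expr1n mulr1.
move=> J idJ [PJ nJP]; have [JP|JT] := mP J idJ PJ; first by case: nJP; rewrite JP.
exists 1%N, (fun=> -1); split=> // [i|]; first by rewrite JT.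
by rewrite big_ord1 expr0 expr1 mulr1 subrr.
Qed.
End Rabinowitsch.

(** * Contractions of maximal left ideals of [R[x_1, ..., x_n, t]] *)

Section Contraction.
Variables (R : nzRingType) (n : nat).
Notation T := {mpoly R[n]}.
Notation S := {poly {mpoly R[n]}}.
Notation iota := (polyC \o @mpolyC n R : {rmorphism R -> S}).

Definition variables : seq S := 'X :: [seq ('X_i)%:P | i <- enum 'I_n].

Lemma variables_central : all_central variables.
Proof.
have cX i : central (('X_i : T)%:P : S).
  by move=> a; apply/polyP => k; rewrite coefMC coefCM; apply: commr_mpolyX.
split; first by move=> a; apply: commr_polyX.
by elim: (enum 'I_n) => //= i s IH; split.
Qed.

Lemma generators_ind (K : S -> Prop) : K 0 -> K 1 ->
  (forall s t, K s -> K t -> K (s + t)) -> (forall s t, K s -> K t -> K (s * t)) ->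
  (forall c, K (iota c)) -> (forall y, y \in variables -> K y) -> forall s, K s.
Proof.
move=> K0 K1 KD KM KC KX.
have KE s k : K s -> K (s ^+ k).
  by move=> Ks; elim: k => [|k IH]; [rewrite expr0|rewrite exprS; apply: KM].
have KT (p : T) : K p%:P.
  rewrite (mpolyE p) (rmorph_sum (polyC : {rmorphism T -> S})).
  apply: (big_ind K) => [||m _]; [exact: K0|exact: (KD)|].
  rewrite -mul_mpolyC (rmorphM (polyC : {rmorphism T -> S})); apply: (KM); first exact: KC.
  rewrite mpolyXE_id (rmorph_prod (polyC : {rmorphism T -> S})).
  apply: (big_ind K) => [||i _]; [exact: K1|exact: (KM)|].
  rewrite (rmorphXn (polyC : {rmorphism T -> S})); apply: (KE); apply: (KX).
  rewrite /variables in_cons; apply/orP; right.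
  by apply: (map_f (fun i => ('X_i : T)%:P)); rewrite mem_enum.
move=> s; rewrite -(coefK s) poly_def.
apply: (big_ind K) => [||i _]; [exact: K0|exact: (KD)|].
rewrite -mul_polyC; apply: (KM); first exact: (KT).
by apply: (KE); apply: (KX); rewrite mem_head.
Qed.

Lemma variables_submod (V : lmodType S) (X : set V) :
  submod (gens variables (range iota)) X -> submod setT X.
Proof.
move=> sX; split; [exact: submod0 sX|by move=> x z; apply: submodB sX|].
move=> s x _; move: s x; apply: generators_ind.
- by move=> x _; rewrite scale0r; apply: submod0 sX.
- by move=> x; rewrite scale1r.
- by move=> s t Ks Kt x Xx; rewrite scalerDl; apply: (submodD sX); [apply: Ks|apply: Kt].
- by move=> s t Ks Kt x Xx; rewrite -scalerA; apply: Ks; apply: Kt.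
- by move=> c x Xx; apply: (submodZ sX) => //; apply: sub_gens; exists c.
move=> y yv x Xx; apply: (submodZ sX) => //; move: yv.
elim: variables (range iota) => [//|z zs IH] A; rewrite inE => /orP[/eqP->|].
  by apply: (@sub_gens _ zs (A `|` [set z])); right.
exact: IH.
Qed.

Theorem contraction_maximal (M : set S) :
  left_fully_bounded R -> left_noetherian R -> jacobson_ring R ->
  maximal_left_ideal M -> finite_intersection_of_maximal_left_ideals (contraction M).
Proof.
move=> /fully_bounded_relatively bR nR jac maxM; have [idM _ _] := maxM.
have [V [v [genv annv]]] := cyclic_module idM.
have v0 : v <> 0.
  by move=> ev; apply: (maximalN1 maxM); apply/annv; rewrite scale1r.
have cys := variables_central.
have simpleV (X : set V) : submod (gens variables (range iota)) X ->
    (forall x, X x -> x = 0) \/ forall x, X x.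
  move=> /variables_submod sX; have [z|nz] := EM (forall x, X x -> x = 0); first by left.
  right; have [x Xx x0] : exists2 x, X x & x <> 0.
    apply: contrapT => no; apply: nz => x Xx; apply: contrapT => x0.
    by apply: no; exists x.
  have [s es] := genv x; rewrite es in Xx x0.
  have [|r Mr] := maximal_sum1 maxM (x := s).
    by move=> /annv.
  have Xv : X v.
    have /annv/eqP := Mr; rewrite scalerBl scale1r subr_eq0 -scalerA => /eqP <-.
    exact: submodZ sX _ _.
  by move=> z; have [t ->] := genv z; apply: submodZ sX _ _.
have prP : prime_ideal (annV iota V) by apply: annV_prime simpleV _ v0.
have [|L maxL coreL] := annV_primitive cys simpleV v0 nR bR.
  by rewrite jac.
have ssP E : left_ideal E -> annV iota V `<=` E -> ess (annV iota V) E -> E 1.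
  by rewrite -coreL; apply: core_ess.
have bA : range iota `<=` range (polyC : T -> S).
  by move=> _ [r _ <-]; exists r%:MP.
(* [Y] is minimal over [R[x_1, ..., x_n]]. Next, [Y[t]] is a nonzero submodule over all the
   variables, hence contains [v], and [v] is a sum of terms [t ^ i u_i] with [u_i] in [Y]. *)
have [Y [sY [y0 Yy0 y0_neq0] minY]] := minimal_submod cys simpleV nR ssP bA v0.
have sadj := adj_submod sY (variables_central).1.
have [d Dv] : adj 'X Y v.
  have [|z|] // := simpleV (adj 'X Y).
    apply: submodW sadj => a /gensP[/bA|]; first by left.
    rewrite inE => /orP[/eqP->|/mapP[i _ ->]]; first by right.
    by left; exists 'X_i.
  by case: y0_neq0; apply: z; apply: sub_adj.
have [u Yu ev] := span_lt_sum (submod0 sY) Dv.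
have -> : contraction M = [set a | (polyC a : S) *: v = 0].
  by apply/seteqP; split=> a; rewrite /contraction /=; move/annv.
apply: (ann_sum_simple (phi := polyC : {rmorphism T -> S}) (u := fun i => 'X^i *: u i)) => //.
move=> i a; rewrite (scalerC _ _ _ (variables_central).1) => nz.
(* [t] being central, [t ^ i u_i] inherits simplicity from [u_i]; the nonzero submodule [Z]
   generated by [a u_i] is all of [Y] by minimality. *)
pose Z := [set x | exists b, x = (polyC (b * a) : S) *: u i].
have YZ : Y `<=` Z.
  apply: minY.
  - split.
    + by exists 0; rewrite mul0r polyC0 scale0r.
    + by move=> _ _ [b ->] [c ->]; exists (b - c); rewrite mulrBl polyCB scalerBl.
    + by move=> _ _ [c _ <-] [b ->]; exists (c * b); rewrite scalerA -polyCM mulrA.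
  - by move=> _ [b ->]; apply: (submodZ sY) => //; exists (b * a).
  - exists ((polyC a : S) *: u i); first by exists 1; rewrite mul1r.
    by move=> z; apply: nz; rewrite z scaler0.
have [b eb] := YZ _ (Yu i).
by exists b; rewrite (scalerC _ _ _ (variables_central).1) -eb.
Qed.

End Contraction.

Theorem theorem3p7 (R : nzRingType) (n : nat)
  (hfb : fully_bounded R) (hnoeth : noetherian R) (hjac : jacobson_ring R)
  (hn : (1 <= n)%N) :
  (forall P : set {mpoly R[n]}, G_left_ideal P ->
     finite_intersection_of_maximal_left_ideals P) /\
  G_left_jacobson {mpoly R[n]}.
Proof.
have finG (P : set {mpoly R[n]}) : G_left_ideal P ->
    finite_intersection_of_maximal_left_ideals P.
  move=> /G_left_contraction [M maxM ->].
  by apply: contraction_maximal => //; [case: hfb|case: hnoeth].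
(* One inclusion holds because maximal left ideals are G-left ideals; for the other, a G-left ideal
   over [I] is an intersection of maximal left ideals, all containing [I]. *)
split=> // I idI; apply/seteqP; split=> x xI P [].
  by move=> maxP IP; apply: xI; split=> //; apply: maximal_G_left.
move=> /finG [k [M [maxM ->]]] IM i _; apply: xI; split=> //.
by move=> z /IM; apply.
Qed.
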